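(* Let $m<k$ be positive integers with $\gcd(m,k)=1$, let $t\ge 2$ be an integer, and let $n=tk$ (case without offset) or $n=2(tk-m)$ (case with offset). In either case, the Modulo Krinkle tiling described in the context (a collection of congruent copies of the prototile) fills the plane correctly: the tiles cover $\mathbb{R}^2$ without gaps, and no two tiles overlap (their interiors are pairwise disjoint).
   Context: For an integer $i$ let $\vec v_i=(\cos\frac{2\pi i}{n},\sin\frac{2\pi i}{n})$. Given a point $\vec p$ and an integer sequence $(a_j)$, the curve defined by $\vec p$ and $(a_j)$ is the polygonal path through $\vec p_0=\vec p$, $\vec p_{j+1}=\vec p_j+\vec v_{a_j}$. Prototile: let $\ell_j=jm \bmod k$ for $0\le j\le k-1$ and $\ell_k=k$; let $(u_0,\dots,u_k)$ be $(\ell_0,\dots,\ell_k)$ with its first and last entries swapped, i.e. $(k,\ell_1,\dots,\ell_{k-1},0)$. The prototile with starting point $P$ is the simple polygon formed by the lower path (curve defined by $P$ and $(\ell_0,\dots,\ell_k)$) followed by the reverse of the upper path (curve defined by $P$ and $(u_0,\dots,u_k)$); both paths end at the same point. Its base edge is the first segment of the lower path. Wedge $0$: with $\vec d_0=\sum_{j=0}^{k-1}\vec v_{\ell_j}$ and $\vec d_1=\vec v_k-\vec v_0$, place, for all integers $0\le c\le r$, a translate $T_{r,c}$ of the prototile with starting point $r\vec d_0+c\vec d_1$. Wedge $0$ is bounded by its lower boundary, the curve from the origin with direction sequence $b_j=\ell^0_j:=jm\bmod k$ ($j\ge0$), and its upper boundary, the curve from the origin with direction sequence $u^0_j$, where $u^0_j=jm\bmod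 k$ if this is nonzero and $u^0_j=k$ otherwise. The base is the curve from the origin with direction sequence $(b_j)$. For $i\ge 0$ set $\ell^i_j=\ell^0_j+i$ and $u^i_j=u^0_j+i$. Placement: let $w=k$ (without offset) or $w=n/2=tk-m$ (with offset). The front after wedge $0$ is $f^0_j=u^0_j$. For $i=1,\dots,w-1$: let $j^*$ be the minimal index with $f^{i-1}_{j^*}=i$; wedge $i$ is wedge $0$ rotated counterclockwise by $\frac{2\pi i}{n}$ about the origin and then translated by $\sum_{j=0}^{j^*-1}\vec v_{f^{i-1}_j}$; the new front is $f^i_j=f^{i-1}_j$ for $j<j^*$ and $f^i_{j^*+j}=u^i_j$ for $j\ge0$ (the upper boundary of the region covered so far). Let $R$ be the union of wedges $0,\dots,w-1$. Final tiling: without offset, the tiling consists of $R$ together with its rotations about the origin by $\frac{2\pi q}{t}$, $q=1,\dots,t-1$. With offset, the tiling consists of $R$ together with the copy of $R$ rotated by $\pi$ about the midpoint of the first base edge (the segment from the origin to $\vec v_0$). *)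

(* Defs.v *)
From Stdlib Require Import Reals Lra Lia Arith List ClassicalEpsilon.
Import ListNotations.
Open Scope R_scope.

Definition R2 : Type := (R * R)%type.

Definition vadd (p q : R2) : R2 := (fst p + fst q, snd p + snd q).
Definition vsub (p q : R2) : R2 := (fst p - fst q, snd p - snd q).
Definition vscale (a : R) (p : R2) : R2 := (a * fst p, a * snd p).
Definition vdot (p q : R2) : R := fst p * fst q + snd p * snd q.
Definition vcross (p q : R2) : R := fst p * snd q - snd p * fst q.
Definition vnorm (p : R2) : R := sqrt (vdot p p).
Definition origin : R2 := (0, 0).

Definition rot (th : R) (p : R2) : R2 :=
  (fst p * cos th - snd p * sin th, fst p * sin th + snd p * cos th).

Definition vdir (n i : nat) : R2 :=
  (cos (2 * PI * INR i / INR n), sin (2 * PI * INR i / INR n)).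

Fixpoint curve_pt (n : nat) (p : R2) (a : nat -> nat) (j : nat) : R2 :=
  match j with
  | O => p
  | S j' => vadd (curve_pt n p a j') (vdir n (a j'))
  end.

Fixpoint edges_aux (first : R2) (l : list R2) : list (R2 * R2) :=
  match l with
  | [] => []
  | [a] => [(a, first)]
  | a :: ((b :: _) as l') => (a, b) :: edges_aux first l'
  end.

Definition edges (vs : list R2) : list (R2 * R2) :=
  match vs with [] => [] | a :: _ => edges_aux a vs end.

Definition on_segment (e : R2 * R2) (x : R2) : Prop :=
  exists s : R, 0 <= s <= 1 /\ x = vadd (fst e) (vscale s (vsub (snd e) (fst e))).

Definition on_boundary (vs : list R2) (x : R2) : Prop :=
  exists e, In e (edges vs) /\ on_segment e x.

(* signed angle in (-pi, pi) under which the edge e is seen from x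
   (half-angle formula; meaningful when x is not on the edge) *)
Definition edge_angle (x : R2) (e : R2 * R2) : R :=
  let p := vsub (fst e) x in
  let q := vsub (snd e) x in
  2 * atan (vcross p q / (vnorm p * vnorm q + vdot p q)).

(* winding number of the polygon around x (x not on the boundary) *)
Definition winding (vs : list R2) (x : R2) : R :=
  fold_right (fun e s => edge_angle x e + s) 0 (edges vs) / (2 * PI).

Definition region (vs : list R2) (x : R2) : Prop :=
  on_boundary vs x \/ winding vs x <> 0.

Definition interior2 (A : R2 -> Prop) (x : R2) : Prop :=
  exists eps : R, 0 < eps /\ forall y, vnorm (vsub y x) < eps -> A y.

Definition lseq (m k : nat) (j : nat) : nat :=
  if (j <? k)%nat then ((j * m) mod k)%nat else k.

Definition useq (m k : nat) (j : nat) : nat :=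
  if (j =? 0)%nat then k else if (j <? k)%nat then ((j * m) mod k)%nat else 0%nat.

(* vertex list of the prototile with starting point P: the lower path
   p_0, ..., p_{k+1} followed by the reverse of the upper path q_k, ..., q_1
   (q_{k+1} = p_{k+1} and q_0 = p_0 = P). *)
Definition prototile (n m k : nat) (P : R2) : list R2 :=
  map (curve_pt n P (lseq m k)) (seq 0 (k + 2)) ++
  map (curve_pt n P (useq m k)) (rev (seq 1 k)).

Definition d0 (n m k : nat) : R2 := curve_pt n origin (lseq m k) k.
Definition d1 (n k : nat) : R2 := vsub (vdir n k) (vdir n 0).

Definition wedge0_tile (n m k r c : nat) : list R2 :=
  prototile n m k (vadd (vscale (INR r) (d0 n m k)) (vscale (INR c) (d1 n k))).

Definition u0 (m k : nat) (j : nat) : nat :=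
  if (((j * m) mod k) =? 0)%nat then k else ((j * m) mod k)%nat.

Definition jmin (f : nat -> nat) (a : nat) : nat :=
  epsilon (inhabits 0%nat) (fun j => f j = a /\ forall j', f j' = a -> (j <= j')%nat).

Fixpoint front (m k : nat) (i : nat) : nat -> nat :=
  match i with
  | O => u0 m k
  | S i' =>
      let f := front m k i' in
      let js := jmin f i in
      fun j => if (j <? js)%nat then f j else (u0 m k (j - js) + i)%nat
  end.

Definition wedge_shift (n m k : nat) (i : nat) : R2 :=
  match i with
  | O => origin
  | S i' => curve_pt n origin (front m k i') (jmin (front m k i') i)
  end.

Definition wedge_tile (n m k i r c : nat) : list R2 :=
  map (fun p => vadd (rot (2 * PI * INR i / INR n) p) (wedge_shift n m k i))
      (wedge0_tile n m k r c).

Definition krinkle_n (offset : bool) (m k t : nat) : nat :=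
  if offset then (2 * (t * k - m))%nat else (t * k)%nat.

Definition krinkle_w (offset : bool) (m k t : nat) : nat :=
  if offset then (t * k - m)%nat else k.

Definition krinkle_copies (offset : bool) (t : nat) : nat :=
  if offset then 2%nat else t.

(* the isometry producing copy q of R:
   without offset, rotation about the origin by 2 pi q / t;
   with offset, q = 0 identity, q = 1 rotation by pi about the midpoint of the
   first base edge [origin, v_0]. *)
Definition copy_map (offset : bool) (n t q : nat) (p : R2) : R2 :=
  if offset then
    (if (q =? 0)%nat then p
     else let M := vscale (1/2) (vadd origin (vdir n 0)) in
          vsub (vscale 2 M) p)
  else rot (2 * PI * INR q / INR t) p.

Definition valid_index (offset : bool) (m k t : nat) (idx : nat * nat * nat * nat) : Prop :=
  let '(q, i, r, c) := idx in
  (q < krinkle_copies offset t)%nat /\ (i < krinkle_w offset m k t)%nat /\ (c <= r)%nat.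

Definition krinkle_tile (offset : bool) (m k t : nat) (idx : nat * nat * nat * nat) : list R2 :=
  let '(q, i, r, c) := idx in
  let n := krinkle_n offset m k t in
  map (copy_map offset n t q) (wedge_tile n m k i r c).

(* Main.v *)
Require Import Defs.
From Stdlib Require Import Reals Arith List.
From Stdlib Require Import Lra Lia ZArith Psatz ClassicalEpsilon.
(* [Stdlib.Reals] shadows [d1]. *)
Import Defs.
Import ListNotations.
Open Scope R_scope.

(** The proof counts winding numbers. The signed angle of an edge changes sign when the
    edge is reversed, so in the sum of the winding numbers of the tiles [r < N] of all
    wedges, every edge shared by two tiles cancels. Within a wedge there remain the two
    boundary paths and a far zigzag seen under an angle close to [2 PI / n]. The front
    below wedge [i] has as [j]-th direction the unique integer of [[i, i + k)] congruent
    to [j m] modulo [k]; hence consecutive wedges share their boundary paths, the last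
    front of the region [R] is the base of the next copy, and the paths cancel up to
    boundedly many far edges. There are [n] wedges, so the sum of the winding numbers
    tends to [1] at every point.

    Sweeping along [d1] writes a tile as a sum of counterclockwise triangles, so its
    winding number is nonnegative everywhere and a natural number off the sides of these
    triangles. Some tile therefore winds around every point, and two tiles with a common
    interior point would make the sum at least [2] at a nearby point. *)

(** * Signed angles *)

(** Signed angles are total here. If [x] lies on an edge, the cross product and the denominator both
    vanish, and [/ 0 = 0] makes the angle 0, so reversing the edge still changes the sign. The
    cancellation therefore needs no hypothesis on the position of [x], and the limit 1 holds on tile
    boundaries as well; covering then follows without any topology of the plane. What fails on
    boundaries is integrality: in the relative interior of an edge each of the two adjacent tiles
    may count 1/2.

    The limit 1 has two sources. The vector [d0 + d1] is [d0] turned by 2π/n, so the far zigzag of a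
    wedge leads from [N d0] to its image under this turn; and wedges per copy times copies is n in
    both cases, k·t or (n/2)·2.

    The placement of the wedges is a recursive search for minimal indices. Describing a front by
    residues and a window determines it completely without knowing these indices, which are never
    computed: a wedge that starts at a later index only adds finitely many far edges to the boundary
    paths. *)

Definition pang (p q : R2) : R :=
  2 * atan (vcross p q / (vnorm p * vnorm q + vdot p q)).

(** Zero exactly when [p] and [q] are opposite or one of them is zero, that is, when the origin lies
    on the segment from [p] to [q]. *)
Definition pden (p q : R2) : R := vnorm p * vnorm q + vdot p q.

Lemma vnorm_ge0 p : 0 <= vnorm p.
Proof. apply sqrt_pos. Qed.

Lemma vdot_self_ge0 p : 0 <= vdot p p.
Proof. unfold vdot; nra. Qed.

Lemma vnorm_sqr p : vnorm p * vnorm p = vdot p p.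
Proof. apply sqrt_sqrt, vdot_self_ge0. Qed.

Lemma vnorm_eq0 p : vnorm p = 0 -> p = origin.
Proof.
  intros H. assert (E := vnorm_sqr p). rewrite H in E. destruct p as [a b].
  unfold vdot in E; simpl in E. unfold origin.
  assert (a = 0) by nra. assert (b = 0) by nra. now subst.
Qed.

Lemma vdot_cross_sqr p q :
  vdot p q * vdot p q + vcross p q * vcross p q = (vnorm p * vnorm q) * (vnorm p * vnorm q).
Proof.
  replace ((vnorm p * vnorm q) * (vnorm p * vnorm q))
    with ((vnorm p * vnorm p) * (vnorm q * vnorm q)) by ring.
  rewrite !vnorm_sqr. unfold vdot, vcross. ring.
Qed.

Lemma vdot_le_norm p q : vdot p q <= vnorm p * vnorm q.
Proof.
  assert (H := vdot_cross_sqr p q).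
  assert (0 <= vnorm p * vnorm q) by (apply Rmult_le_pos; apply vnorm_ge0).
  nra.
Qed.

Lemma vdot_ge_norm p q : - (vnorm p * vnorm q) <= vdot p q.
Proof.
  assert (H := vdot_cross_sqr p q).
  assert (0 <= vnorm p * vnorm q) by (apply Rmult_le_pos; apply vnorm_ge0).
  nra.
Qed.

Lemma vcross_le_norm p q : Rabs (vcross p q) <= vnorm p * vnorm q.
Proof.
  assert (H := vdot_cross_sqr p q).
  assert (0 <= vnorm p * vnorm q) by (apply Rmult_le_pos; apply vnorm_ge0).
  apply Rabs_le; split; nra.
Qed.

Lemma vnorm_vadd p q : vnorm (vadd p q) <= vnorm p + vnorm q.
Proof.
  assert (H := vdot_le_norm p q).
  assert (Hp := vnorm_ge0 p). assert (Hq := vnorm_ge0 q).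
  assert (Ep := vnorm_sqr p). assert (Eq := vnorm_sqr q).
  assert (Es := vnorm_sqr (vadd p q)). assert (Hs := vnorm_ge0 (vadd p q)).
  assert (vdot (vadd p q) (vadd p q) = vdot p p + 2 * vdot p q + vdot q q)
    by (unfold vdot, vadd; simpl; ring).
  nra.
Qed.

Lemma vnorm_vscale s p : vnorm (vscale s p) = Rabs s * vnorm p.
Proof.
  unfold vnorm. replace (vdot (vscale s p) (vscale s p)) with (s² * vdot p p)
    by (unfold vdot, vscale, Rsqr; simpl; ring).
  rewrite sqrt_mult_alt by apply Rle_0_sqr. now rewrite sqrt_Rsqr_abs.
Qed.

Lemma pden_ge0 p q : 0 <= pden p q.
Proof. unfold pden. assert (H := vdot_ge_norm p q). lra. Qed.

Lemma pang_antisym p q : pang q p = - pang p q.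
Proof.
  unfold pang.
  replace (vcross q p / (vnorm q * vnorm p + vdot q p))
    with (- (vcross p q / (vnorm p * vnorm q + vdot p q))).
  - rewrite atan_opp. ring.
  - replace (vcross q p) with (- vcross p q) by (unfold vcross; ring).
    replace (vnorm q * vnorm p + vdot q p) with (vnorm p * vnorm q + vdot p q)
      by (unfold vdot; ring).
    unfold Rdiv. ring.
Qed.

Lemma pang_bound p q : - PI < pang p q < PI.
Proof.
  unfold pang. destruct (atan_bound (vcross p q / (vnorm p * vnorm q + vdot p q))).
  lra.
Qed.

Lemma pang_ge0 p q : 0 <= vcross p q -> 0 <= pang p q.
Proof.
  intros H. unfold pang. assert (D := pden_ge0 p q). unfold pden in D.
  assert (0 <= vcross p q / (vnorm p * vnorm q + vdot p q)).
  { destruct D as [D|D].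
    - apply Rmult_le_pos; [exact H|]. left. now apply Rinv_0_lt_compat.
    - rewrite <- D. unfold Rdiv. rewrite Rinv_0. lra. }
  destruct H0 as [H0|H0].
  - apply atan_increasing in H0. rewrite atan_0 in H0. lra.
  - rewrite <- H0, atan_0. lra.
Qed.

Lemma pang_le0 p q : vcross p q <= 0 -> pang p q <= 0.
Proof.
  intros H. rewrite pang_antisym.
  assert (0 <= pang q p); [|lra].
  apply pang_ge0. replace (vcross q p) with (- vcross p q) by (unfold vcross; ring). lra.
Qed.

Lemma pang_eq0 p q : vcross p q = 0 -> pang p q = 0.
Proof.
  intros H. apply Rle_antisym; [apply pang_le0 | apply pang_ge0]; lra.
Qed.

Lemma vdot_rot th p q : vdot (rot th p) (rot th q) = vdot p q.
Proof.
  unfold vdot, rot; simpl. assert (H := sin2_cos2 th). unfold Rsqr in H.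
  replace (fst p * fst q + snd p * snd q) with
    ((fst p * fst q + snd p * snd q) * (sin th * sin th + cos th * cos th))
    by (rewrite H; ring). ring.
Qed.

Lemma vcross_rot th p q : vcross (rot th p) (rot th q) = vcross p q.
Proof.
  unfold vcross, rot; simpl. assert (H := sin2_cos2 th). unfold Rsqr in H.
  replace (fst p * snd q - snd p * fst q) with
    ((fst p * snd q - snd p * fst q) * (sin th * sin th + cos th * cos th))
    by (rewrite H; ring). ring.
Qed.

Lemma vnorm_rot th p : vnorm (rot th p) = vnorm p.
Proof. unfold vnorm. now rewrite vdot_rot. Qed.

Lemma pang_rot th p q : pang (rot th p) (rot th q) = pang p q.
Proof. unfold pang. now rewrite vcross_rot, vdot_rot, !vnorm_rot. Qed.

Lemma pang_vscale s p q : 0 < s -> pang (vscale s p) (vscale s q) = pang p q.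
Proof.
  intros Hs. unfold pang. do 2 f_equal. rewrite !vnorm_vscale, Rabs_pos_eq by lra.
  replace (vcross (vscale s p) (vscale s q)) with ((s * s) * vcross p q)
    by (unfold vcross, vscale; simpl; ring).
  replace (s * vnorm p * (s * vnorm q) + vdot (vscale s p) (vscale s q))
    with ((s * s) * (vnorm p * vnorm q + vdot p q))
    by (unfold vdot, vscale; simpl; ring).
  apply Rdiv_mult_l_l. nra.
Qed.

Lemma cos_2atan z : cos (2 * atan z) = (1 - z * z) / (1 + z * z).
Proof.
  rewrite cos_2a_cos, cos_atan.
  assert (0 < 1 + z²) by (unfold Rsqr; nra).
  replace (2 * (1 / sqrt (1 + z²)) * (1 / sqrt (1 + z²)))
    with (2 / (sqrt (1 + z²) * sqrt (1 + z²))).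
  - rewrite sqrt_sqrt by lra. unfold Rsqr in *. field. lra.
  - assert (0 < sqrt (1 + z²)) by now apply sqrt_lt_R0. field. lra.
Qed.

Lemma sin_2atan z : sin (2 * atan z) = 2 * z / (1 + z * z).
Proof.
  rewrite sin_2a, cos_atan, sin_atan.
  assert (0 < 1 + z²) by (unfold Rsqr; nra).
  replace (2 * (z / sqrt (1 + z²)) * (1 / sqrt (1 + z²)))
    with (2 * z / (sqrt (1 + z²) * sqrt (1 + z²))).
  - rewrite sqrt_sqrt by lra. unfold Rsqr in *. field. lra.
  - assert (0 < sqrt (1 + z²)) by now apply sqrt_lt_R0. field. lra.
Qed.

Lemma pden_pos_norm p q : 0 < pden p q -> 0 < vnorm p * vnorm q.
Proof. unfold pden. intros H. assert (H1 := vdot_le_norm p q). lra. Qed.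

(** The tangent of the half angle is c/(N + d), with N the product of the norms. By c² + d² = N² the
    double angle formulas give d/N and c/N, so [pang] is a genuine angle whenever the denominator is
    positive. *)
Lemma pang_cos_sin p q : 0 < pden p q ->
  cos (pang p q) * (vnorm p * vnorm q) = vdot p q /\
  sin (pang p q) * (vnorm p * vnorm q) = vcross p q.
Proof.
  intros H. assert (Hn := pden_pos_norm _ _ H).
  unfold pang. rewrite cos_2atan, sin_2atan.
  assert (E := vdot_cross_sqr p q). unfold pden in H.
  set (N := vnorm p * vnorm q) in *. set (d := vdot p q) in *. set (c := vcross p q) in *.
  assert (c * c = (N - d) * (N + d)) by lra.
  assert (E1 : 1 + c / (N + d) * (c / (N + d)) = 2 * N / (N + d)).
  { replace (c / (N + d) * (c / (N + d))) with ((c * c) / ((N + d) * (N + d))) by (field; lra).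
    rewrite H0. field. lra. }
  assert (E2 : 1 - c / (N + d) * (c / (N + d)) = 2 * d / (N + d)).
  { replace (c / (N + d) * (c / (N + d))) with ((c * c) / ((N + d) * (N + d))) by (field; lra).
    rewrite H0. field. lra. }
  rewrite E1, E2. split; field; lra.
Qed.

(** In complex notation, (p̄ q)(q̄ r)(r̄ p) = |p|²|q|²|r|² is a positive real, so the three
    arguments add up to a multiple of 2π. *)
Lemma cos_pang_sum p q r : 0 < pden p q -> 0 < pden q r -> 0 < pden r p ->
  cos (pang p q + pang q r + pang r p) = 1.
Proof.
  intros H1 H2 H3.
  destruct (pang_cos_sin _ _ H1) as [C1 S1].
  destruct (pang_cos_sin _ _ H2) as [C2 S2].
  destruct (pang_cos_sin _ _ H3) as [C3 S3].
  assert (N1 := pden_pos_norm _ _ H1).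
  assert (N2 := pden_pos_norm _ _ H2).
  assert (N3 := pden_pos_norm _ _ H3).
  set (A := pang p q) in *. set (B := pang q r) in *. set (C := pang r p) in *.
  set (n1 := vnorm p * vnorm q) in *. set (n2 := vnorm q * vnorm r) in *.
  set (n3 := vnorm r * vnorm p) in *.
  rewrite !cos_plus, sin_plus.
  apply Rmult_eq_reg_r with (n1 * n2 * n3).
  2:{ apply Rgt_not_eq, Rmult_lt_0_compat; [apply Rmult_lt_0_compat|]; assumption. }
  transitivity ((cos A * n1) * (cos B * n2) * (cos C * n3)
    - (sin A * n1) * (sin B * n2) * (cos C * n3)
    - (sin A * n1) * (cos B * n2) * (sin C * n3)
    - (cos A * n1) * (sin B * n2) * (sin C * n3)); [ring|].
  rewrite C1, C2, C3, S1, S2, S3. unfold n1, n2, n3.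
  replace (1 * (vnorm p * vnorm q * (vnorm q * vnorm r) * (vnorm r * vnorm p)))
    with ((vnorm p * vnorm p) * (vnorm q * vnorm q) * (vnorm r * vnorm r)) by ring.
  rewrite !vnorm_sqr. unfold vdot, vcross. ring.
Qed.

Lemma cos_eq1_cases S : cos S = 1 -> - (3 * PI) < S < 3 * PI ->
  S = 0 \/ S = 2 * PI \/ S = - (2 * PI).
Proof.
  intros H [L U]. assert (P := PI_RGT_0).
  assert (Hs : sin (S / 2) = 0).
  { assert (E := cos_2a_sin (S / 2)). replace (2 * (S / 2)) with S in E by field.
    rewrite H in E. nra. }
  apply sin_eq_0_0 in Hs. destruct Hs as [z Hz].
  assert (E : S = 2 * IZR z * PI) by lra.
  assert (IZR z < 2) by (apply Rmult_lt_reg_r with PI; lra).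
  assert (-2 < IZR z) by (apply Rmult_lt_reg_r with PI; lra).
  apply lt_IZR in H0. apply lt_IZR in H1.
  assert (C : (z = 0 \/ z = 1 \/ z = -1)%Z) by lia.
  destruct C as [-> | [-> | ->]]; [left | right; left | right; right]; lra.
Qed.

Lemma pang_sum_cases p q r : 0 < pden p q -> 0 < pden q r -> 0 < pden r p ->
  let S := pang p q + pang q r + pang r p in
  S = 0 \/ S = 2 * PI \/ S = - (2 * PI).
Proof.
  intros H1 H2 H3 S. apply cos_eq1_cases.
  - now apply cos_pang_sum.
  - unfold S. assert (A := pang_bound p q). assert (B := pang_bound q r).
    assert (C := pang_bound r p). lra.
Qed.

(** Each angle exceeds -π, so a sum of -2π would need three negative angles; but one of the three
    cross products is nonnegative. *)
Lemma pang_sum_ccw p q r : 0 < pden p q -> 0 < pden q r -> 0 < pden r p ->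
  0 <= vcross p q + vcross q r + vcross r p ->
  pang p q + pang q r + pang r p = 0 \/ pang p q + pang q r + pang r p = 2 * PI.
Proof.
  intros H1 H2 H3 H.
  assert (A := pang_bound p q). assert (B := pang_bound q r). assert (C := pang_bound r p).
  destruct (pang_sum_cases p q r H1 H2 H3) as [E | [E | E]]; [now left | now right |].
  exfalso.
  destruct (Rle_dec 0 (vcross p q)) as [P | P].
  { apply pang_ge0 in P. lra. }
  destruct (Rle_dec 0 (vcross q r)) as [Q | Q].
  { apply pang_ge0 in Q. lra. }
  assert (R0 : 0 <= vcross r p) by lra. apply pang_ge0 in R0. lra.
Qed.

(** Equality case of Cauchy-Schwarz: |q| p + |p| q has squared norm 2 |p| |q| [pden p q]. *)
Lemma pden_eq0 p q : pden p q = 0 ->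
  vcross p q = 0 /\ vadd (vscale (vnorm q) p) (vscale (vnorm p) q) = origin.
Proof.
  unfold pden. intros H. split.
  - assert (E := vdot_cross_sqr p q). nra.
  - apply vnorm_eq0. set (z := vadd _ _). assert (E := vnorm_sqr z).
    assert (vdot z z = 0).
    { unfold z.
      transitivity (vnorm q * vnorm q * vdot p p + vnorm p * vnorm p * vdot q q
        + 2 * (vnorm p * vnorm q) * vdot p q).
      - unfold vdot, vadd, vscale; simpl; ring.
      - rewrite <- !vnorm_sqr. replace (vdot p q) with (- (vnorm p * vnorm q)) by lra. ring. }
    nra.
Qed.

(** For opposite p and q, |q| (r × p) = |p| (q × r), so the two remaining cross products do not have
    strictly opposite signs and both are nonnegative. Zero vectors are treated apart. *)
Lemma pang_sum_ge0_degenerate p q r : pden p q = 0 ->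
  0 <= vcross p q + vcross q r + vcross r p ->
  0 <= pang p q + pang q r + pang r p.
Proof.
  intros H Hs. apply pden_eq0 in H. destruct H as [C E].
  rewrite (pang_eq0 _ _ C).
  assert (Hp := vnorm_ge0 p). assert (Hq := vnorm_ge0 q).
  assert (K : vnorm q * vcross r p = vnorm p * vcross q r).
  { assert (vcross r (vadd (vscale (vnorm q) p) (vscale (vnorm p) q)) = 0)
      by (rewrite E; unfold vcross, origin; simpl; ring).
    unfold vcross, vadd, vscale in *; simpl in *. lra. }
  destruct (Req_dec (vnorm p) 0) as [P|P]; [destruct (Req_dec (vnorm q) 0) as [Q|Q]|].
  - apply vnorm_eq0 in P, Q. subst.
    rewrite !pang_eq0 by (unfold vcross, origin; simpl; ring). lra.
  - assert (vcross r p = 0) by nra.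
    rewrite (pang_eq0 r p) by assumption.
    assert (0 <= pang q r) by (apply pang_ge0; lra). lra.
  - assert (0 <= vcross q r) by nra. assert (0 <= vcross r p) by nra.
    apply pang_ge0 in H, H0. lra.
Qed.

Lemma pang_sum_ge0 p q r :
  0 <= vcross p q + vcross q r + vcross r p ->
  0 <= pang p q + pang q r + pang r p.
Proof.
  intros H. assert (P := PI_RGT_0).
  destruct (pden_ge0 p q) as [A|A].
  2:{ apply pang_sum_ge0_degenerate; [lra | exact H]. }
  destruct (pden_ge0 q r) as [B|B].
  2:{ assert (G := pang_sum_ge0_degenerate q r p). lra. }
  destruct (pden_ge0 r p) as [C|C].
  2:{ assert (G := pang_sum_ge0_degenerate r p q). lra. }
  destruct (pang_sum_ccw p q r A B C H); lra.
Qed.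

Lemma vdot_pos_pden e p q : 0 < vdot p e -> 0 < vdot q e -> 0 < pden p q.
Proof.
  intros Hp Hq. destruct (pden_ge0 p q) as [D|D]; [exact D|exfalso].
  symmetry in D. apply pden_eq0 in D. destruct D as [_ D].
  assert (vdot (vadd (vscale (vnorm q) p) (vscale (vnorm p) q)) e = 0)
    by (rewrite D; unfold vdot, origin; simpl; ring).
  assert (vnorm q * vdot p e + vnorm p * vdot q e = 0)
    by (unfold vdot, vadd, vscale in *; simpl in *; lra).
  assert (Np := vnorm_ge0 p). assert (Nq := vnorm_ge0 q).
  assert (vnorm q = 0) by nra.
  apply vnorm_eq0 in H1. subst q. unfold vdot, origin in Hq; simpl in Hq. lra.
Qed.

(* The identity [p×q r + q×r p + r×p q = 0], paired with [e], shows that the three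
   cross products cannot all have the same strict sign, so the sum is not ±2π. *)
Lemma pang_add_halfplane e p q r :
  0 < vdot p e -> 0 < vdot q e -> 0 < vdot r e ->
  pang p q + pang q r = pang p r.
Proof.
  intros Hp Hq Hr.
  assert (I : vcross p q * vdot r e + vcross q r * vdot p e + vcross r p * vdot q e = 0)
    by (unfold vcross, vdot; ring).
  assert (A := pang_bound p q). assert (B := pang_bound q r). assert (C := pang_bound r p).
  assert (S := pang_sum_cases p q r (vdot_pos_pden e p q Hp Hq)
    (vdot_pos_pden e q r Hq Hr) (vdot_pos_pden e r p Hr Hp)).
  rewrite (pang_antisym r p). simpl in S. destruct S as [S|[S|S]]; [lra| |]; exfalso.
  - destruct (Rle_dec (vcross p q) 0) as [P|P]; [apply pang_le0 in P; lra|].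
    destruct (Rle_dec (vcross q r) 0) as [Q|Q]; [apply pang_le0 in Q; lra|].
    destruct (Rle_dec (vcross r p) 0) as [R|R]; [apply pang_le0 in R; lra|].
    nra.
  - destruct (Rle_dec 0 (vcross p q)) as [P|P]; [apply pang_ge0 in P; lra|].
    destruct (Rle_dec 0 (vcross q r)) as [Q|Q]; [apply pang_ge0 in Q; lra|].
    destruct (Rle_dec 0 (vcross r p)) as [R|R]; [apply pang_ge0 in R; lra|].
    nra.
Qed.

Lemma Rabs_atan_le z : Rabs (atan z) <= Rabs z.
Proof.
  assert (G : forall y, 0 <= y -> atan y <= y).
  { intros y [Hy|Hy].
    - destruct (MVT_cor2 atan (fun t => / (1 + t * t)) 0 y Hy) as [c [E [L U]]].
      { intros c _. assert (D := derivable_pt_lim_atan c).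
        replace (1 + c * c) with (1 + c ^ 2) by ring. exact D. }
      rewrite atan_0 in E.
      assert (/ (1 + c * c) <= 1).
      { rewrite <- Rinv_1. apply Rinv_le_contravar; nra. }
      nra.
    - rewrite <- Hy, atan_0. lra. }
  destruct (Rle_dec 0 z) as [H|H].
  - rewrite (Rabs_pos_eq z) by lra. rewrite Rabs_pos_eq; [now apply G|].
    destruct H as [H|H]; [apply atan_increasing in H; rewrite atan_0 in H; lra|].
    rewrite <- H, atan_0; lra.
  - rewrite (Rabs_left z) by lra. rewrite Rabs_left1.
    + rewrite <- atan_opp. apply G. lra.
    + assert (Hz : z < 0) by lra. apply atan_increasing in Hz. rewrite atan_0 in Hz. lra.
Qed.

(** The numerator is p × v, at most |p| in absolute value. The denominator is at least |p|² - |p|,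
    hence at least |p|²/2 once |p| ≥ 2. The factor 2 of the half-angle formula then gives 4/|p|. *)
Lemma pang_far p v : vnorm v = 1 -> 2 <= vnorm p ->
  Rabs (pang p (vadd p v)) <= 4 / vnorm p.
Proof.
  intros Hv Hp. unfold pang. rewrite Rabs_mult, (Rabs_pos_eq 2) by lra.
  eapply Rle_trans; [apply Rmult_le_compat_l, Rabs_atan_le; lra|].
  assert (Ec : vcross p (vadd p v) = vcross p v) by (unfold vcross, vadd; simpl; ring).
  assert (Ed : vdot p (vadd p v) = vdot p p + vdot p v) by (unfold vdot, vadd; simpl; ring).
  rewrite Ec, Ed. assert (C := vcross_le_norm p v). assert (D := vdot_ge_norm p v).
  rewrite Hv in C, D. assert (Q := vnorm_ge0 (vadd p v)). rewrite <- vnorm_sqr.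
  set (a := vnorm p) in *. set (D0 := a * vnorm (vadd p v) + (a * a + vdot p v)).
  assert (L : a * a / 2 <= D0) by (unfold D0; nra).
  assert (0 < a * a / 2) by nra.
  unfold Rdiv at 1. rewrite Rabs_mult, (Rabs_pos_eq (/ D0)).
  2:{ left. apply Rinv_0_lt_compat. lra. }
  assert (/ D0 <= / (a * a / 2)) by (apply Rinv_le_contravar; lra).
  assert (0 < / D0) by (apply Rinv_0_lt_compat; lra).
  apply Rle_trans with (2 * (a * / (a * a / 2))).
  - apply Rmult_le_compat_l; [lra|]. apply Rmult_le_compat; try lra. apply Rabs_pos.
  - right. field. lra.
Qed.

Lemma pang_rot_self phi d : 0 < phi < PI -> 0 < vnorm d -> pang d (rot phi d) = phi.
Proof.
  intros [H1 H2] Hd. unfold pang. rewrite vnorm_rot.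
  assert (Ec : vcross d (rot phi d) = vdot d d * sin phi)
    by (unfold vcross, vdot, rot; simpl; ring).
  assert (Ed : vdot d (rot phi d) = vdot d d * cos phi)
    by (unfold vdot, rot; simpl; ring).
  rewrite Ec, Ed, vnorm_sqr.
  assert (0 < vdot d d) by (rewrite <- vnorm_sqr; nra).
  assert (Hc : 0 < cos (phi / 2)) by (apply cos_gt_0; lra).
  replace (vdot d d * sin phi / (vdot d d + vdot d d * cos phi)) with (tan (phi / 2)).
  - rewrite atan_tan by lra. field.
  - replace phi with (2 * (phi / 2)) at 2 3 by field.
    rewrite sin_2a, cos_2a_cos. unfold tan. field. split; [|lra].
    replace (vdot d d + vdot d d * (2 * cos (phi / 2) * cos (phi / 2) - 1))
      with (2 * vdot d d * (cos (phi / 2) * cos (phi / 2))) by ring.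
    apply Rgt_not_eq. apply Rmult_lt_0_compat; [lra|]. now apply Rmult_lt_0_compat.
Qed.

Lemma not_on_segment_pden x A B :
  ~ on_segment (A, B) x -> 0 < pden (vsub A x) (vsub B x).
Proof.
  intros H. destruct (pden_ge0 (vsub A x) (vsub B x)) as [D|D]; [exact D|].
  exfalso. apply H. symmetry in D. apply pden_eq0 in D. destruct D as [_ D].
  set (p := vsub A x) in *. set (q := vsub B x) in *.
  assert (Hp := vnorm_ge0 p). assert (Hq := vnorm_ge0 q).
  destruct (Req_dec (vnorm p) 0) as [P|P].
  - exists 0. split; [lra|]. apply vnorm_eq0 in P. unfold p, vsub, origin in P.
    injection P as P1 P2. destruct x, A. unfold vadd, vscale. simpl in *. f_equal; lra.
  (* By |q| p + |p| q = 0 the point [x] divides the segment in the ratio of its distances to the two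
     ends. *)
  - exists (vnorm p / (vnorm p + vnorm q)). split.
    + split.
      * apply Rmult_le_pos; [lra|]. left. apply Rinv_0_lt_compat. lra.
      * apply Rmult_le_reg_r with (vnorm p + vnorm q); [lra|]. field_simplify; lra.
    + unfold vadd, vscale, origin in D. injection D as D1 D2.
      destruct x as [x1 x2], A as [a1 a2], B as [b1 b2].
      unfold p, q, vsub, vadd, vscale in *; simpl in *.
      set (np := vnorm (a1 - x1, a2 - x2)) in *.
      set (nq := vnorm (b1 - x1, b2 - x2)) in *.
      f_equal; apply Rmult_eq_reg_r with (np + nq); try lra;
        field_simplify; lra.
Qed.

(** * Chains and triangulated polygons *)

Fixpoint bsum (n : nat) (f : nat -> R) : R :=
  match n with O => 0 | S n' => bsum n' f + f n' end.

Lemma bsum_ext n f g : (forall j, (j < n)%nat -> f j = g j) -> bsum n f = bsum n g.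
Proof.
  induction n as [|n IH]; intros H; simpl; [reflexivity|].
  rewrite IH, H by (auto with arith; intros; apply H; lia). reflexivity.
Qed.

Lemma bsum_plus n f g : bsum n (fun j => f j + g j) = bsum n f + bsum n g.
Proof. induction n as [|n IH]; simpl; [ring|]. rewrite IH. ring. Qed.

Lemma bsum_minus n f g : bsum n (fun j => f j - g j) = bsum n f - bsum n g.
Proof. induction n as [|n IH]; simpl; [ring|]. rewrite IH. ring. Qed.

Lemma bsum_telescope n f : bsum n (fun j => f j - f (S j)) = f O - f n.
Proof. induction n as [|n IH]; simpl; [ring|]. rewrite IH. ring. Qed.

Lemma bsum_add a b f : bsum (a + b) f = bsum a f + bsum b (fun j => f (a + j)%nat).
Proof.
  induction b as [|b IH]; simpl.
  - rewrite Nat.add_0_r. ring.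
  - rewrite Nat.add_succ_r. simpl. rewrite IH. ring.
Qed.

Lemma bsum_scal n c f : bsum n (fun j => c * f j) = c * bsum n f.
Proof. induction n as [|n IH]; simpl; [ring|]. rewrite IH. ring. Qed.

Lemma bsum_S_l n f : bsum (S n) f = f O + bsum n (fun j => f (S j)).
Proof. change (S n) with (1 + n)%nat. rewrite bsum_add. simpl. ring. Qed.

Definition lsum {A : Type} (f : A -> R) (l : list A) : R :=
  fold_right (fun a s => f a + s) 0 l.

Lemma lsum_app {A} (f : A -> R) l1 l2 : lsum f (l1 ++ l2) = lsum f l1 + lsum f l2.
Proof. induction l1 as [|a l IH]; simpl; [ring|]. rewrite IH. ring. Qed.

Lemma lsum_map {A B} (f : B -> R) (g : A -> B) l : lsum f (map g l) = lsum (fun a => f (g a)) l.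
Proof. induction l as [|a l IH]; simpl; [ring|]. rewrite IH. ring. Qed.

Lemma lsum_ext {A} (f g : A -> R) l : (forall a, In a l -> f a = g a) -> lsum f l = lsum g l.
Proof.
  induction l as [|a l IH]; simpl; intros H; [reflexivity|].
  rewrite H, IH; auto.
Qed.

Lemma lsum_flat_map {A B} (f : B -> R) (g : A -> list B) l :
  lsum f (flat_map g l) = lsum (fun a => lsum f (g a)) l.
Proof. induction l as [|a l IH]; simpl; [ring|]. rewrite lsum_app, IH. ring. Qed.

Lemma lsum_seq f n : lsum f (seq 0 n) = bsum n f.
Proof.
  induction n as [|n IH]; [reflexivity|].
  rewrite seq_S, lsum_app, IH. simpl. ring.
Qed.

Lemma lsum_ge0 {A} (f : A -> R) l : (forall a, In a l -> 0 <= f a) -> 0 <= lsum f l.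
Proof.
  induction l as [|a l IH]; simpl; intros H; [lra|].
  assert (0 <= f a) by auto. assert (0 <= lsum f l) by auto. lra.
Qed.

Lemma lsum_ge_one {A} (f : A -> R) l a :
  (forall b, 0 <= f b) -> In a l -> f a <= lsum f l.
Proof.
  intros H. induction l as [|b l IH]; simpl; [tauto|]. intros [E|E].
  - subst b. assert (0 <= lsum f l) by (apply lsum_ge0; auto). lra.
  - specialize (IH E). specialize (H b). lra.
Qed.

Lemma lsum_ge_two {A} (f : A -> R) l a b :
  (forall c, 0 <= f c) -> In a l -> In b l -> a <> b -> f a + f b <= lsum f l.
Proof.
  intros H. induction l as [|c l IH]; simpl; [tauto|]. intros [E|E] [F|F] N.
  - congruence.
  - subst c. assert (G := lsum_ge_one f l b H F). lra.
  - subst c. assert (G := lsum_ge_one f l a H E). lra.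
  - specialize (IH E F N). specialize (H c). lra.
Qed.

Lemma lsum_neq0 {A} (f : A -> R) l : lsum f l <> 0 -> exists a, In a l /\ f a <> 0.
Proof.
  induction l as [|a l IH]; simpl; intros H; [lra|].
  destruct (Req_dec (f a) 0) as [E|E].
  - destruct IH as [b [I J]]; [lra|]. exists b; auto.
  - exists a; auto.
Qed.

Lemma edge_angle_pang x A B : edge_angle x (A, B) = pang (vsub A x) (vsub B x).
Proof. reflexivity. Qed.

Lemma edge_angle_rev x A B : edge_angle x (B, A) = - edge_angle x (A, B).
Proof. apply pang_antisym. Qed.

Definition angle_sum (x : R2) (vs : list R2) : R := lsum (edge_angle x) (edges vs).

Lemma winding_angle_sum vs x : winding vs x = angle_sum x vs / (2 * PI).
Proof. reflexivity. Qed.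

(** Angle sum of an open path. A closed polygon is an open path with its first vertex repeated at
    the end, and in this form it can be split and reversed. *)
Fixpoint psum (x : R2) (l : list R2) : R :=
  match l with
  | a :: ((b :: _) as l') => edge_angle x (a, b) + psum x l'
  | _ => 0
  end.

Lemma edges_aux_psum x first l :
  l <> [] -> lsum (edge_angle x) (edges_aux first l) = psum x (l ++ [first]).
Proof.
  induction l as [|a [|b l] IH]; intros H; [congruence|reflexivity|].
  change (edge_angle x (a, b) + lsum (edge_angle x) (edges_aux first (b :: l)) =
    edge_angle x (a, b) + psum x ((b :: l) ++ [first])).
  rewrite IH by discriminate. reflexivity.
Qed.

Lemma psum_app x l1 a l2 : psum x (l1 ++ a :: l2) = psum x (l1 ++ [a]) + psum x (a :: l2).
Proof.
  induction l1 as [|b [|c l1] IH].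
  - simpl. ring.
  - simpl. ring.
  - change (edge_angle x (b, c) + psum x ((c :: l1) ++ a :: l2) =
      edge_angle x (b, c) + psum x ((c :: l1) ++ [a]) + psum x (a :: l2)).
    rewrite IH. ring.
Qed.

Lemma psum_rev x l : psum x (rev l) = - psum x l.
Proof.
  induction l as [|a [|b l] IH]; [simpl; ring|simpl; ring|].
  change (psum x ((rev l ++ [b]) ++ [a]) = - (edge_angle x (a, b) + psum x (b :: l))).
  rewrite <- app_assoc. change ([b] ++ [a]) with (b :: [a]). rewrite psum_app.
  change (rev l ++ [b]) with (rev (b :: l)). rewrite IH. simpl.
  rewrite (edge_angle_rev x a b). ring.
Qed.

Definition csum (x : R2) (c : nat -> R2) (J : nat) : R :=
  bsum J (fun j => edge_angle x (c j, c (S j))).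

Lemma psum_map_seq x c s J :
  psum x (map c (seq s (S J))) = bsum J (fun j => edge_angle x (c (s + j)%nat, c (S (s + j)))).
Proof.
  revert s. induction J as [|J IH]; intros s; [reflexivity|].
  rewrite bsum_S_l, Nat.add_0_r.
  change (edge_angle x (c s, c (S s)) + psum x (map c (seq (S s) (S J))) =
    edge_angle x (c s, c (S s)) +
    bsum J (fun j => edge_angle x (c (s + S j)%nat, c (S (s + S j))))).
  rewrite IH. f_equal. apply bsum_ext. intros j _.
  now replace (s + S j)%nat with (S s + j)%nat by lia.
Qed.

Ltac vsolve :=
  repeat match goal with p : R2 |- _ => destruct p end;
  unfold vadd, vsub, vscale, origin; simpl; f_equal; ring.

Lemma lseq_0 m k : (0 < k)%nat -> lseq m k 0 = 0%nat.
Proof.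
  intros H. unfold lseq. destruct (Nat.ltb_spec 0 k); [|lia].
  simpl. apply Nat.Div0.mod_0_l.
Qed.

Lemma lseq_k m k : lseq m k k = k.
Proof. unfold lseq. now rewrite Nat.ltb_irrefl. Qed.

Lemma useq_0 m k : useq m k 0 = k.
Proof. reflexivity. Qed.

Lemma useq_k m k : (0 < k)%nat -> useq m k k = 0%nat.
Proof.
  intros H. unfold useq. rewrite Nat.ltb_irrefl.
  destruct (Nat.eqb_spec k 0); [lia|reflexivity].
Qed.

Lemma useq_mid m k j : (0 < j < k)%nat -> useq m k j = lseq m k j.
Proof.
  intros H. unfold useq, lseq. destruct (Nat.eqb_spec j 0); [lia|]. now destruct (Nat.ltb_spec j k); [|lia].
Qed.

Lemma curve_useq n m k P j : (0 < j <= k)%nat ->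
  curve_pt n P (useq m k) j = vadd (curve_pt n P (lseq m k) j) (d1 n k).
Proof.
  destruct j as [|j]; [lia|]. induction j as [|j IH]; intros H.
  - simpl curve_pt. rewrite useq_0, lseq_0 by lia. unfold d1. vsolve.
  - change (curve_pt n P (useq m k) (S (S j)))
      with (vadd (curve_pt n P (useq m k) (S j)) (vdir n (useq m k (S j)))).
    rewrite IH, useq_mid by lia.
    change (curve_pt n P (lseq m k) (S (S j)))
      with (vadd (curve_pt n P (lseq m k) (S j)) (vdir n (lseq m k (S j)))).
    vsolve.
Qed.

Lemma curve_useq_end n m k P : (0 < k)%nat ->
  curve_pt n P (useq m k) (S k) = curve_pt n P (lseq m k) (S k).
Proof.
  intros H. simpl. rewrite curve_useq, useq_k, lseq_k by lia. unfold d1. vsolve.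
Qed.

Lemma prototile_angle_sum n m k P x : (0 < k)%nat ->
  angle_sum x (prototile n m k P) =
  csum x (curve_pt n P (lseq m k)) (S k) - csum x (curve_pt n P (useq m k)) (S k).
Proof.
  intros Hk. unfold angle_sum, prototile.
  set (cl := curve_pt n P (lseq m k)). set (cu := curve_pt n P (useq m k)).
  replace (k + 2)%nat with (S (S k)) by lia.
  set (L := map cl (seq 0 (S (S k))) ++ map cu (rev (seq 1 k))).
  assert (E : edges L = edges_aux P L) by reflexivity.
  rewrite E, edges_aux_psum by (unfold L; simpl; discriminate).
  (* Closing the polygon with [P] supplies vertex 0 of the upper path; the common end [cl (S k)] of
     the two paths occurs once and is where the list is cut. *)
  assert (E2 : L ++ [P] = map cl (seq 0 (S k)) ++ cl (S k) :: rev (map cu (seq 0 (S k)))).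
  { unfold L. rewrite (seq_S (S k)), map_app, <- !app_assoc.
    simpl plus. change (map cl [S k]) with [cl (S k)]. f_equal. simpl app at 1. f_equal.
    rewrite <- !map_rev. change (seq 0 (S k)) with (0%nat :: seq 1 k). simpl rev.
    rewrite map_app. reflexivity. }
  rewrite E2, psum_app.
  replace (map cl (seq 0 (S k)) ++ [cl (S k)]) with (map cl (seq 0 (S (S k))))
    by (rewrite (seq_S (S k)), map_app; reflexivity).
  replace (cl (S k) :: rev (map cu (seq 0 (S k)))) with (rev (map cu (seq 0 (S (S k))))).
  2:{ rewrite (seq_S (S k)), map_app, rev_app_distr. simpl.
      f_equal. apply curve_useq_end. exact Hk. }
  rewrite psum_rev, !psum_map_seq. unfold csum. simpl plus. ring.
Qed.

(** * Counterclockwise triangles and the sign of the winding number *)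

Definition triangle : Type := (R2 * R2 * R2)%type.

Definition tri_angle (x : R2) (T : triangle) : R :=
  let '(A, B, C) := T in
  edge_angle x (A, B) + edge_angle x (B, C) + edge_angle x (C, A).

(** The inequality is weak because for n = 2k the vectors v_0 and v_k are opposite and the two end
    triangles of a tile are flat. *)
Definition ccw (T : triangle) : Prop :=
  let '(A, B, C) := T in 0 <= vcross (vsub B A) (vsub C A).

Definition tri_edges (T : triangle) : list (R2 * R2) :=
  let '(A, B, C) := T in [(A, B); (B, C); (C, A)].

Lemma ccw_vcross x A B C : ccw (A, B, C) ->
  0 <= vcross (vsub A x) (vsub B x) + vcross (vsub B x) (vsub C x)
     + vcross (vsub C x) (vsub A x).
Proof. unfold ccw, vcross, vsub; simpl. lra. Qed.

Lemma tri_angle_ge0 x T : ccw T -> 0 <= tri_angle x T.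
Proof.
  destruct T as [[A B] C]. intros H. apply (ccw_vcross x) in H.
  now apply pang_sum_ge0.
Qed.

Lemma tri_angle_cases x T : ccw T -> (forall e, In e (tri_edges T) -> ~ on_segment e x) ->
  tri_angle x T = 0 \/ tri_angle x T = 2 * PI.
Proof.
  destruct T as [[A B] C]. intros H Hx. apply (ccw_vcross x) in H.
  apply pang_sum_ccw; [| | |exact H]; apply not_on_segment_pden, Hx; simpl; auto.
Qed.

(* As 1-chains, the polygon [vs] is the sum of the counterclockwise triangles [tris]. *)
Definition triangulated (vs : list R2) (tris : list triangle) : Prop :=
  (forall T, In T tris -> ccw T) /\
  forall x, angle_sum x vs = lsum (tri_angle x) tris.

(** Valid at every point, also on the sides of the triangles. When two tiles are compared inside a
    patch, only their own segments have to be avoided, not those of the other tiles. *)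
Lemma triangulated_winding_ge0 vs tris x : triangulated vs tris -> 0 <= winding vs x.
Proof.
  intros [H E]. rewrite winding_angle_sum, E. assert (P := PI_RGT_0).
  apply Rmult_le_pos; [|left; apply Rinv_0_lt_compat; lra].
  apply lsum_ge0. intros T HT. apply tri_angle_ge0; auto.
Qed.

Lemma triangulated_winding_ge1 vs tris x : triangulated vs tris ->
  (forall e, In e (flat_map tri_edges tris) -> ~ on_segment e x) ->
  winding vs x <> 0 -> 1 <= winding vs x.
Proof.
  intros [H E] Hx. rewrite winding_angle_sum, E. assert (P := PI_RGT_0). clear E.
  assert (C : lsum (tri_angle x) tris = 0 \/ 2 * PI <= lsum (tri_angle x) tris).
  { induction tris as [|T l IH]; simpl; [now left|].
    assert (CT : tri_angle x T = 0 \/ tri_angle x T = 2 * PI).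
    { apply tri_angle_cases; [apply H; now left|].
      intros e He. apply Hx. simpl. apply in_or_app. now left. }
    destruct IH as [IH|IH].
    - intros T' HT'. apply H. now right.
    - intros e He. apply Hx. simpl. apply in_or_app. now right.
    - destruct CT; [left|right]; lra.
    - right. destruct CT; lra. }
  intros N. destruct C as [C|C].
  - exfalso. apply N. rewrite C. unfold Rdiv. ring.
  - apply Rmult_le_reg_r with (2 * PI); [lra|]. unfold Rdiv.
    rewrite Rmult_assoc, Rinv_l by lra. lra.
Qed.

(** * Transport of angles by direct isometries *)

Definition gmap (th : R) (s p : R2) : R2 := vadd (rot th p) s.
(** The inverse isometry. A moved tile seen from [x] is the original tile seen from [ginv th s x],
    so every wedge is studied as wedge 0 with a moved viewpoint. *)
Definition ginv (th : R) (s x : R2) : R2 := rot (- th) (vsub x s).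

Lemma gmap_vsub th s A x : vsub (gmap th s A) x = rot th (vsub A (ginv th s x)).
Proof.
  destruct A as [a b], x as [u v], s as [c d]. unfold gmap, ginv, vsub, vadd, rot; simpl.
  rewrite cos_neg, sin_neg. assert (H := sin2_cos2 th). unfold Rsqr in H.
  set (S := sin th) in *. set (C := cos th) in *.
  f_equal.
  - transitivity (a * C - b * S - (u - c) * (S * S + C * C)); [rewrite H; ring|ring].
  - transitivity (a * S + b * C - (v - d) * (S * S + C * C)); [rewrite H; ring|ring].
Qed.

Lemma gmap_vsub2 th s A B : vsub (gmap th s A) (gmap th s B) = rot th (vsub A B).
Proof. unfold gmap, rot. vsolve. Qed.

Lemma edge_angle_gmap th s x A B :
  edge_angle x (gmap th s A, gmap th s B) = edge_angle (ginv th s x) (A, B).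
Proof. rewrite !edge_angle_pang, !gmap_vsub. apply pang_rot. Qed.

Lemma edges_map (g : R2 -> R2) vs :
  edges (map g vs) = map (fun e => (g (fst e), g (snd e))) (edges vs).
Proof.
  assert (G : forall f l, edges_aux (g f) (map g l) =
     map (fun e => (g (fst e), g (snd e))) (edges_aux f l)).
  { intros f l. induction l as [|a [|b l] IH]; [reflexivity|reflexivity|].
    change ((g a, g b) :: edges_aux (g f) (map g (b :: l)) =
      (g a, g b) :: map (fun e => (g (fst e), g (snd e))) (edges_aux f (b :: l))).
    now rewrite IH. }
  destruct vs as [|a l]; [reflexivity|]. unfold edges at 2. rewrite <- G. reflexivity.
Qed.

Lemma angle_sum_gmap th s x vs :
  angle_sum x (map (gmap th s) vs) = angle_sum (ginv th s x) vs.
Proof.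
  unfold angle_sum. rewrite edges_map, lsum_map. apply lsum_ext.
  intros [A B] _. apply edge_angle_gmap.
Qed.

Lemma triangulated_gmap th s vs tris : triangulated vs tris ->
  exists tris', triangulated (map (gmap th s) vs) tris'.
Proof.
  intros [H E].
  exists (map (fun T : triangle => let '(A, B, C) := T in
    (gmap th s A, gmap th s B, gmap th s C)) tris).
  split.
  - intros T HT. apply in_map_iff in HT. destruct HT as [[[A B] C] [<- I]].
    apply H in I. unfold ccw in *. now rewrite !gmap_vsub2, vcross_rot.
  - intros x. rewrite angle_sum_gmap, E, lsum_map. apply lsum_ext.
    intros [[A B] C] _. simpl. now rewrite !edge_angle_gmap.
Qed.

(** The steps from [p 1] to [p k] sweep out k - 1 parallelograms along [d], each cut by a diagonal
    into two triangles. The first two entries are the caps at the ends [P] and [p (S k)] of the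
    tile. *)
Definition tile_triangles (n m k : nat) (P : R2) : list triangle :=
  let p := curve_pt n P (lseq m k) in
  let d := d1 n k in
  (P, p 1%nat, vadd (p 1%nat) d)
  :: (p k, p (S k), vadd (p k) d)
  :: map (fun j => (p (S j), p (S (S j)), vadd (p (S (S j))) d)) (seq 0 (k - 1))
  ++ map (fun j => (p (S j), vadd (p (S (S j))) d, vadd (p (S j)) d)) (seq 0 (k - 1)).

Lemma vdir_cross n a b :
  vcross (vdir n a) (vdir n b) = sin (2 * PI * INR b / INR n - 2 * PI * INR a / INR n).
Proof. unfold vcross, vdir; simpl. rewrite sin_minus. ring. Qed.

Lemma angle_range n a b : (0 < n)%nat -> (a <= b)%nat -> (2 * (b - a) <= n)%nat ->
  0 <= 2 * PI * INR b / INR n - 2 * PI * INR a / INR n <= PI.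
Proof.
  intros Hn Hab H. assert (P := PI_RGT_0). assert (N := lt_0_INR _ Hn).
  apply le_INR in H. rewrite mult_INR, minus_INR in H by lia. simpl in H.
  apply le_INR in Hab.
  replace (2 * PI * INR b / INR n - 2 * PI * INR a / INR n)
    with (PI * (2 * (INR b - INR a) / INR n)) by (field; lra).
  assert (0 <= 2 * (INR b - INR a) / INR n <= 1).
  { split.
    - apply Rmult_le_pos; [lra|]. left. now apply Rinv_0_lt_compat.
    - apply Rmult_le_reg_r with (INR n); [lra|]. unfold Rdiv.
      rewrite Rmult_assoc, Rinv_l by lra. lra. }
  nra.
Qed.

Lemma vdir_cross_ge0 n a b : (0 < n)%nat -> (a <= b)%nat -> (2 * (b - a) <= n)%nat ->
  0 <= vcross (vdir n a) (vdir n b).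
Proof.
  intros Hn Hab H. rewrite vdir_cross. destruct (angle_range n a b Hn Hab H).
  now apply sin_ge_0.
Qed.

(** The product splits as v_l × v_k + v_0 × v_l, and both angles lie in [0, π] because 0 ≤ l ≤ k ≤
    n/2. *)
Lemma vcross_d1_ge0 n k l : (0 < n)%nat -> (l <= k)%nat -> (2 * k <= n)%nat ->
  0 <= vcross (vdir n l) (d1 n k).
Proof.
  intros Hn Hl Hk.
  replace (vcross (vdir n l) (d1 n k))
    with (vcross (vdir n l) (vdir n k) + vcross (vdir n 0) (vdir n l))
    by (unfold d1, vcross, vsub; simpl; ring).
  assert (A := vdir_cross_ge0 n l k Hn Hl ltac:(lia)).
  assert (B := vdir_cross_ge0 n 0 l Hn ltac:(lia) ltac:(lia)). lra.
Qed.

Lemma lseq_le m k j : (0 < k)%nat -> (lseq m k j <= k)%nat.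
Proof.
  intros H. unfold lseq. destruct (j <? k)%nat; [|lia].
  assert (G := Nat.mod_upper_bound (j * m) k). lia.
Qed.

Lemma tile_triangles_ccw n m k P : (0 < k)%nat -> (2 * k <= n)%nat ->
  forall T, In T (tile_triangles n m k P) -> ccw T.
Proof.
  intros Hk Hn T. unfold tile_triangles. set (p := curve_pt n P (lseq m k)).
  assert (Hp : forall j, p (S j) = vadd (p j) (vdir n (lseq m k j))) by reflexivity.
  assert (Hl : forall j, 0 <= vcross (vdir n (lseq m k j)) (d1 n k)).
  { intros j. apply vcross_d1_ge0; [lia| now apply lseq_le|exact Hn]. }
  assert (V0 := Hl 0%nat). assert (Vk := Hl k). rewrite lseq_0 in V0 by lia.
  rewrite lseq_k in Vk.
  intros [<- | [<- | HT]].
  - unfold ccw. rewrite Hp, lseq_0 by lia. change (p 0%nat) with P.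
    revert V0. unfold vcross, vsub, vadd; simpl. intros V0.
    match goal with |- _ <= ?e => match type of V0 with _ <= ?f => replace e with f by ring end end.
    exact V0.
  - unfold ccw. rewrite Hp, lseq_k. revert Vk. unfold vcross, vsub, vadd; simpl. intros V.
    match goal with |- _ <= ?e => match type of V with _ <= ?f => replace e with f by ring end end.
    exact V.
  - apply in_app_or in HT. destruct HT as [HT|HT]; apply in_map_iff in HT;
      destruct HT as [j [<- _]]; unfold ccw; rewrite (Hp (S j)); generalize (Hl (S j));
      unfold vcross, vsub, vadd; simpl; intros V;
      match goal with |- _ <= ?e => match type of V with _ <= ?f => replace e with f by ring end end;
      exact V.
Qed.

(* The tile is swept by translating the middle part of the lower path by [d1];
   the diagonals introduced by the triangles cancel in pairs. *)
Lemma tile_triangulated n m k P : (0 < k)%nat -> (2 * k <= n)%nat ->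
  triangulated (prototile n m k P) (tile_triangles n m k P).
Proof.
  intros Hk Hn. split; [now apply tile_triangles_ccw|].
  intros x. rewrite prototile_angle_sum by exact Hk. unfold tile_triangles, csum.
  set (p := curve_pt n P (lseq m k)). set (u := curve_pt n P (useq m k)).
  set (d := d1 n k).
  assert (Hu : forall j, (0 < j <= k)%nat -> u j = vadd (p j) d)
    by (intros; now apply curve_useq).
  assert (Hue : u (S k) = p (S k)) by now apply curve_useq_end.
  change (P) with (p 0%nat).
  destruct k as [|k']; [lia|]. replace (S k' - 1)%nat with k' by lia.
  assert (Q : forall a b : nat -> triangle, forall A B,
    lsum (tri_angle x) (A :: B :: map a (seq 0 k') ++ map b (seq 0 k')) =
    tri_angle x A + tri_angle x B +
     bsum k' (fun j => tri_angle x (a j) + tri_angle x (b j))).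
  { intros a b A B. rewrite bsum_plus. simpl. fold (lsum (tri_angle x)).
    rewrite lsum_app, !lsum_map, !lsum_seq. ring. }
  rewrite Q. clear Q.
  (* The two halves of a parallelogram share a diagonal, which cancels; the sides parallel to [d]
     remain and telescope in [j]. *)
  rewrite (bsum_ext k' _ (fun j =>
    (edge_angle x (p (S j), p (S (S j))) - edge_angle x (u (S j), u (S (S j)))) -
    (edge_angle x (p (S j), vadd (p (S j)) d)
     - edge_angle x (p (S (S j)), vadd (p (S (S j))) d)))).
  2:{ intros j Hj. rewrite !Hu by lia. unfold tri_angle.
      rewrite (edge_angle_rev x (p (S j)) (vadd (p (S (S j))) d)).
      rewrite (edge_angle_rev x (vadd (p (S j)) d) (vadd (p (S (S j))) d)).
      rewrite (edge_angle_rev x (p (S j)) (vadd (p (S j)) d)). ring. }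
  rewrite bsum_minus, (bsum_telescope k' (fun j => edge_angle x (p (S j), vadd (p (S j)) d))).
  rewrite bsum_minus.
  rewrite (bsum_S_l (S k')), (bsum_S_l (S k') (fun j => edge_angle x (u j, u (S j)))).
  change (bsum (S k') (fun j => edge_angle x (p (S j), p (S (S j)))))
    with (bsum k' (fun j => edge_angle x (p (S j), p (S (S j))))
          + edge_angle x (p (S k'), p (S (S k')))).
  change (bsum (S k') (fun j => edge_angle x (u (S j), u (S (S j)))))
    with (bsum k' (fun j => edge_angle x (u (S j), u (S (S j))))
          + edge_angle x (u (S k'), u (S (S k')))).
  rewrite Hue, !(Hu (S k')), !(Hu 1%nat) by lia. change (u 0%nat) with (p 0%nat).
  unfold tri_angle.
  rewrite (edge_angle_rev x (p 0%nat) (vadd (p 1%nat) d)).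
  rewrite (edge_angle_rev x (vadd (p (S k')) d) (p (S (S k')))).
  rewrite (edge_angle_rev x (p (S k')) (vadd (p (S k')) d)).
  ring.
Qed.

(** * Wedges and fronts *)

(** Here [a], [b], [M] stand for the edge in direction v_0, the edge in direction v_k and the middle
    path at the lattice point (r, c). What survives is the column c = 0 (lower boundary), the
    diagonal (upper boundary) and the row N (far side). *)
Lemma triangle_telescope (a b M : nat -> nat -> R) N :
  bsum N (fun r => bsum (S r) (fun c =>
    (a r c + M r c + b (S r) c) - (b r c + M r (S c) + a (S r) (S c)))) =
  bsum N (fun r => a r O + M r O) - bsum N (fun r => b r r + M r (S r))
  + bsum N (fun c => b N c - a N (S c)).
Proof.
  induction N as [|N IH]; [simpl; ring|].
  change (bsum (S N) ?f) with (bsum N f + f N). cbv beta.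
  rewrite IH. rewrite (bsum_ext (S N) _ (fun c =>
    ((M N c - M N (S c)) + (a N c - b N c)) + (b (S N) c - a (S N) (S c))))
    by (intros; ring).
  rewrite !bsum_plus, bsum_telescope, !bsum_minus.
  rewrite (bsum_S_l N (a N)). simpl. ring.
Qed.

Definition base (m k j : nat) : nat := ((j * m) mod k)%nat.

Lemma curve_pt_translate n P a j :
  curve_pt n P a j = vadd P (curve_pt n origin a j).
Proof.
  induction j as [|j IH]; simpl; [vsolve|]. rewrite IH.
  generalize (vdir n (a j)), (curve_pt n origin a j). intros. vsolve.
Qed.

Lemma curve_pt_ext n P a b j : (forall i, (i < j)%nat -> a i = b i) ->
  curve_pt n P a j = curve_pt n P b j.
Proof.
  induction j as [|j IH]; intros H; simpl; [reflexivity|].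
  rewrite IH, H by (intros; try apply H; lia). reflexivity.
Qed.

Lemma curve_pt_add n P a s j :
  curve_pt n P a (s + j) = curve_pt n (curve_pt n P a s) (fun i => a (s + i)%nat) j.
Proof.
  induction j as [|j IH]; [now rewrite Nat.add_0_r|].
  rewrite Nat.add_succ_r. simpl. now rewrite IH.
Qed.

Lemma mul_mod_neq0 m k j : Nat.gcd m k = 1%nat -> (0 < j < k)%nat -> ((j * m) mod k <> 0)%nat.
Proof.
  intros G H E. apply Nat.Lcm0.mod_divide in E. rewrite Nat.mul_comm in E.
  apply Nat.gauss in E; [|now rewrite Nat.gcd_comm].
  apply Nat.divide_pos_le in E; lia.
Qed.

Lemma base_period m k r j : base m k (r * k + j) = base m k j.
Proof.
  unfold base. replace ((r * k + j) * m)%nat with (j * m + (r * m) * k)%nat by ring.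
  apply Nat.Div0.mod_add.
Qed.

Lemma u0_period m k r j : u0 m k (r * k + j) = u0 m k j.
Proof. unfold u0. fold (base m k (r * k + j)) (base m k j). now rewrite base_period. Qed.

Lemma lseq_base m k j : (j < k)%nat -> lseq m k j = base m k j.
Proof. intros H. unfold lseq. now destruct (Nat.ltb_spec j k); [|lia]. Qed.

(** Coprimality keeps the residue 0 away from 0 < j < k, so in each period [u0] replaces only the
    first entry by k. *)
Lemma useq_u0 m k j : Nat.gcd m k = 1%nat -> (j < k)%nat -> useq m k j = u0 m k j.
Proof.
  intros G H. unfold u0. destruct j as [|j].
  - rewrite useq_0. simpl. now rewrite Nat.Div0.mod_0_l.
  - rewrite useq_mid by lia. assert (E := mul_mod_neq0 m k (S j) G ltac:(lia)).
    destruct (Nat.eqb_spec ((S j * m) mod k) 0); [contradiction|]. now apply lseq_base.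
Qed.

Lemma curve_base n m k r j : (j <= k)%nat ->
  curve_pt n origin (base m k) (r * k + j) =
  curve_pt n (vscale (INR r) (d0 n m k)) (lseq m k) j.
Proof.
  intros H. rewrite curve_pt_add.
  rewrite (curve_pt_ext _ _ _ (lseq m k))
    by (intros i Hi; rewrite base_period, lseq_base by lia; reflexivity).
  f_equal. clear j H. induction r as [|r IH].
  - simpl. unfold vscale, origin. simpl. f_equal; ring.
  - replace (S r * k)%nat with (r * k + k)%nat by lia.
    rewrite curve_pt_add, IH.
    rewrite (curve_pt_ext _ _ _ (lseq m k))
      by (intros i Hi; rewrite base_period, lseq_base by lia; reflexivity).
    rewrite curve_pt_translate. fold (d0 n m k). rewrite S_INR. vsolve.
Qed.

Lemma curve_u0 n m k r j : Nat.gcd m k = 1%nat -> (0 < k)%nat -> (j <= k)%nat ->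
  curve_pt n origin (u0 m k) (r * k + j) =
  curve_pt n (vscale (INR r) (vadd (d0 n m k) (d1 n k))) (useq m k) j.
Proof.
  intros G Hk H. rewrite curve_pt_add.
  rewrite (curve_pt_ext _ _ _ (useq m k))
    by (intros i Hi; rewrite u0_period, useq_u0 by (assumption || lia); reflexivity).
  f_equal. clear j H. induction r as [|r IH].
  - simpl. unfold vscale, origin. simpl. f_equal; ring.
  - replace (S r * k)%nat with (r * k + k)%nat by lia.
    rewrite curve_pt_add, IH.
    rewrite (curve_pt_ext _ _ _ (useq m k))
      by (intros i Hi; rewrite u0_period, useq_u0 by (assumption || lia); reflexivity).
    rewrite curve_pt_translate, curve_useq by lia. fold (d0 n m k). rewrite S_INR.
    generalize (d0 n m k), (d1 n k). intros. vsolve.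
Qed.

Lemma csum_blocks z c N k :
  csum z c (N * k) =
  bsum N (fun r => bsum k (fun j => edge_angle z (c (r * k + j)%nat, c (r * k + S j)%nat))).
Proof.
  unfold csum. induction N as [|N IH]; [reflexivity|].
  replace (S N * k)%nat with (N * k + k)%nat by lia. rewrite bsum_add, IH. simpl. f_equal.
  apply bsum_ext. intros j _. now rewrite Nat.add_succ_r.
Qed.

(** * Cancellation inside wedge 0 *)

Definition lattice_pt (n m k r c : nat) : R2 :=
  vadd (vscale (INR r) (d0 n m k)) (vscale (INR c) (d1 n k)).

(** Far side of the first N rows. A step v_k from the lattice point (N, c) and a reversed step v_0
    lead to (N, c + 1), because the two points differ by [d1] = v_k - v_0. *)
Definition zigzag (n m k : nat) (z : R2) (N : nat) : R :=
  bsum N (fun c =>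
    edge_angle z (lattice_pt n m k N c, vadd (lattice_pt n m k N c) (vdir n k))
    - edge_angle z (lattice_pt n m k N (S c), vadd (lattice_pt n m k N (S c)) (vdir n 0))).

Definition mid_sum (n m k : nat) (z P : R2) : R :=
  bsum (k - 1) (fun j => edge_angle z (curve_pt n P (lseq m k) (S j),
                                       curve_pt n P (lseq m k) (S (S j)))).

Lemma csum_lower n m k z P : (0 < k)%nat ->
  bsum k (fun j => edge_angle z (curve_pt n P (lseq m k) j, curve_pt n P (lseq m k) (S j))) =
  edge_angle z (P, vadd P (vdir n 0)) + mid_sum n m k z P.
Proof.
  intros Hk. destruct k as [|k]; [lia|]. rewrite bsum_S_l. unfold mid_sum.
  replace (S k - 1)%nat with k by lia. f_equal.
  change (curve_pt n P (lseq m (S k)) 1) with (vadd P (vdir n (lseq m (S k) 0))).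
  now rewrite lseq_0 by lia.
Qed.

Lemma csum_upper n m k z P : (0 < k)%nat ->
  bsum k (fun j => edge_angle z (curve_pt n P (useq m k) j, curve_pt n P (useq m k) (S j))) =
  edge_angle z (P, vadd P (vdir n k)) + mid_sum n m k z (vadd P (d1 n k)).
Proof.
  intros Hk. destruct k as [|k]; [lia|]. rewrite bsum_S_l. unfold mid_sum.
  replace (S k - 1)%nat with k by lia. f_equal. apply bsum_ext. intros j Hj.
  assert (T : forall i, (0 < i <= S k)%nat -> curve_pt n P (useq m (S k)) i =
    curve_pt n (vadd P (d1 n (S k))) (lseq m (S k)) i).
  { intros i Hi. rewrite curve_useq by lia.
    rewrite (curve_pt_translate _ P), (curve_pt_translate _ (vadd P _)).
    generalize (d1 n (S k)), (curve_pt n origin (lseq m (S k)) i). intros. vsolve. }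
  now rewrite !T by lia.
Qed.

(** The last lower step starts at [P + d0] and the last upper step at [P + d0 + d1], the lattice
    points (r + 1, c) and (r + 1, c + 1). Every piece of the tile's boundary is thus attached to a
    lattice point. *)
Lemma wedge0_tile_angle n m k z r c : (0 < k)%nat ->
  let a r c := edge_angle z (lattice_pt n m k r c, vadd (lattice_pt n m k r c) (vdir n 0)) in
  let b r c := edge_angle z (lattice_pt n m k r c, vadd (lattice_pt n m k r c) (vdir n k)) in
  let M r c := mid_sum n m k z (lattice_pt n m k r c) in
  angle_sum z (wedge0_tile n m k r c) =
  (a r c + M r c + b (S r) c) - (b r c + M r (S c) + a (S r) (S c)).
Proof.
  intros Hk a b M. unfold wedge0_tile. rewrite prototile_angle_sum by exact Hk.
  fold (lattice_pt n m k r c). set (P := lattice_pt n m k r c). unfold csum.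
  change (bsum (S k) ?f) with (bsum k f + f k). cbv beta.
  rewrite csum_lower, csum_upper by exact Hk.
  change (curve_pt n P (lseq m k) (S k))
    with (vadd (curve_pt n P (lseq m k) k) (vdir n (lseq m k k))).
  change (curve_pt n P (useq m k) (S k))
    with (vadd (curve_pt n P (useq m k) k) (vdir n (useq m k k))).
  rewrite lseq_k, useq_k by exact Hk.
  rewrite curve_useq by lia.
  rewrite curve_pt_translate. fold (d0 n m k).
  replace (vadd P (d0 n m k)) with (lattice_pt n m k (S r) c).
  2:{ unfold P, lattice_pt. rewrite S_INR. generalize (d0 n m k), (d1 n k). intros. vsolve. }
  replace (vadd (lattice_pt n m k (S r) c) (d1 n k)) with (lattice_pt n m k (S r) (S c)).
  2:{ unfold lattice_pt. rewrite (S_INR c). generalize (d0 n m k), (d1 n k). intros. vsolve. }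
  replace (vadd P (d1 n k)) with (lattice_pt n m k r (S c)).
  2:{ unfold P, lattice_pt. rewrite S_INR. generalize (d0 n m k), (d1 n k). intros. vsolve. }
  unfold a, b, M. fold P. ring.
Qed.

Lemma wedge0_angle_sum n m k z N : Nat.gcd m k = 1%nat -> (0 < k)%nat ->
  bsum N (fun r => bsum (S r) (fun c => angle_sum z (wedge0_tile n m k r c))) =
  csum z (curve_pt n origin (base m k)) (N * k)
  - csum z (curve_pt n origin (u0 m k)) (N * k) + zigzag n m k z N.
Proof.
  intros G Hk.
  set (a r c := edge_angle z (lattice_pt n m k r c, vadd (lattice_pt n m k r c) (vdir n 0))).
  set (b r c := edge_angle z (lattice_pt n m k r c, vadd (lattice_pt n m k r c) (vdir n k))).
  set (M r c := mid_sum n m k z (lattice_pt n m k r c)).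
  transitivity (bsum N (fun r => bsum (S r) (fun c =>
    (a r c + M r c + b (S r) c) - (b r c + M r (S c) + a (S r) (S c))))).
  { apply bsum_ext. intros r _. apply bsum_ext. intros c _. now apply wedge0_tile_angle. }
  rewrite triangle_telescope, !csum_blocks. f_equal. f_equal.
  - apply bsum_ext. intros r _. unfold a, M.
    rewrite <- csum_lower by exact Hk. apply bsum_ext. intros j Hj.
    rewrite !curve_base by lia.
    replace (lattice_pt n m k r 0) with (vscale (INR r) (d0 n m k)); [reflexivity|].
    unfold lattice_pt. simpl INR at 2. generalize (d0 n m k), (d1 n k). intros. vsolve.
  - apply bsum_ext. intros r _. unfold b, M.
    replace (lattice_pt n m k r (S r)) with (vadd (lattice_pt n m k r r) (d1 n k)).
    2:{ unfold lattice_pt. rewrite (S_INR r). generalize (d0 n m k), (d1 n k). intros. vsolve. }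
    rewrite <- csum_upper by exact Hk. apply bsum_ext. intros j Hj.
    rewrite !curve_u0 by (assumption || lia).
    replace (lattice_pt n m k r r) with (vscale (INR r) (vadd (d0 n m k) (d1 n k)));
      [reflexivity|].
    unfold lattice_pt. generalize (d0 n m k), (d1 n k). intros. vsolve.
Qed.

Lemma vdir_add n a i : vdir n (a + i) = rot (2 * PI * INR i / INR n) (vdir n a).
Proof.
  unfold vdir, rot; simpl. rewrite plus_INR.
  replace (2 * PI * (INR a + INR i) / INR n)
    with (2 * PI * INR a / INR n + 2 * PI * INR i / INR n) by (unfold Rdiv; ring).
  rewrite cos_plus, sin_plus. f_equal; ring.
Qed.

(** Adding i to a direction turns it by 2πi/n; hence a tail of a front that repeats a boundary of
    wedge 0 with i added is the image of that boundary under the placement of wedge i. *)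
Lemma curve_shift n f g s i j : (forall j, f (s + j)%nat = (g j + i)%nat) ->
  curve_pt n origin f (s + j) =
  gmap (2 * PI * INR i / INR n) (curve_pt n origin f s) (curve_pt n origin g j).
Proof.
  intros H. induction j as [|j IH].
  - rewrite Nat.add_0_r. unfold gmap, rot. simpl. generalize (curve_pt n origin f s). intros. vsolve.
  - rewrite Nat.add_succ_r. simpl. rewrite IH, H, vdir_add. unfold gmap, rot.
    generalize (vdir n (g j)), (curve_pt n origin f s), (curve_pt n origin g j).
    intros. vsolve.
Qed.

Lemma csum_shift n f g s i J x : (forall j, f (s + j)%nat = (g j + i)%nat) ->
  csum (ginv (2 * PI * INR i / INR n) (curve_pt n origin f s) x) (curve_pt n origin g) J =
  csum x (curve_pt n origin f) (s + J) - csum x (curve_pt n origin f) s.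
Proof.
  intros H. unfold csum. rewrite bsum_add.
  rewrite (bsum_ext J (fun j => edge_angle x
    (curve_pt n origin f (s + j), curve_pt n origin f (S (s + j))))
    (fun j => edge_angle (ginv (2 * PI * INR i / INR n) (curve_pt n origin f s) x)
       (curve_pt n origin g j, curve_pt n origin g (S j)))).
  - ring.
  - intros j _. rewrite <- Nat.add_succ_r, !(curve_shift n f g s i _ H).
    apply edge_angle_gmap.
Qed.

(** * Fronts modulo [k] *)

Lemma mod_window_unique k i a b : (i <= a < i + k)%nat -> (i <= b < i + k)%nat ->
  (a mod k = b mod k)%nat -> a = b.
Proof.
  intros Ha Hb E. assert (A := Nat.div_mod_eq a k). assert (B := Nat.div_mod_eq b k).
  rewrite E in A. set (p := (a / k)%nat) in *. set (q := (b / k)%nat) in *.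
  set (r := (b mod k)%nat) in *. assert (p = q) by nia. subst p. nia.
Qed.

Lemma mul_mod_surj m k i : Nat.gcd m k = 1%nat -> (0 < m)%nat ->
  exists j, ((j * m) mod k = i mod k)%nat.
Proof.
  intros G Hm. destruct (Nat.gcd_bezout_pos m k Hm) as [a [b E]]. rewrite G in E.
  exists (a * i)%nat. replace (a * i * m)%nat with (i + (i * b) * k)%nat by nia.
  apply Nat.Div0.mod_add.
Qed.

Lemma base_lt m k j : (0 < k)%nat -> (base m k j < k)%nat.
Proof. intros H. apply Nat.mod_upper_bound. lia. Qed.

Lemma u0_spec m k j : (0 < k)%nat ->
  (1 <= u0 m k j <= k)%nat /\ (u0 m k j mod k = (j * m) mod k)%nat.
Proof.
  intros H. unfold u0. assert (B := Nat.mod_upper_bound (j * m) k ltac:(lia)).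
  destruct (Nat.eqb_spec ((j * m) mod k) 0) as [E|E].
  - rewrite E, Nat.Div0.mod_same. lia.
  - rewrite Nat.Div0.mod_mod. lia.
Qed.

(* [fr i] is the front on which wedge [i] is placed, starting at index [js i]. *)
Definition fr (m k i : nat) : nat -> nat :=
  match i with O => base m k | S i' => front m k i' end.

Definition js (m k i : nat) : nat :=
  match i with O => O | S i' => jmin (front m k i') i end.

Lemma wedge_shift_js n m k i : wedge_shift n m k i = curve_pt n origin (fr m k i) (js m k i).
Proof. destruct i; reflexivity. Qed.

Lemma fr_S m k i j :
  fr m k (S i) j = if (j <? js m k i)%nat then fr m k i j else (u0 m k (j - js m k i) + i)%nat.
Proof.
  destruct i as [|i]; [|reflexivity].
  simpl. destruct (Nat.ltb_spec j 0); [lia|]. now rewrite Nat.sub_0_r, Nat.add_0_r.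
Qed.

Definition fr_window (m k i : nat) : Prop :=
  forall j, (i <= fr m k i j < i + k)%nat /\ (fr m k i j mod k = (j * m) mod k)%nat.

(** [jmin] is an epsilon term, so a minimal index must be shown to exist. Coprimality gives some j
    with j m ≡ i modulo k, and there the window forces the value i. *)
Lemma js_spec m k i : Nat.gcd m k = 1%nat -> (0 < m)%nat -> (0 < k)%nat -> fr_window m k i ->
  fr m k i (js m k i) = i /\ forall j, fr m k i j = i -> (js m k i <= j)%nat.
Proof.
  intros G Hm Hk W. destruct i as [|i].
  - simpl. split; [|intros; lia]. unfold base. simpl. apply Nat.Div0.mod_0_l.
  - unfold js, jmin. apply (epsilon_spec (inhabits 0%nat)
      (fun j => fr m k (S i) j = S i /\ forall j', fr m k (S i) j' = S i -> (j <= j')%nat)).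
    destruct (mul_mod_surj m k (S i) G Hm) as [j0 E].
    assert (E0 : fr m k (S i) j0 = S i).
    { destruct (W j0) as [W1 W2]. apply (mod_window_unique k (S i)); [lia|lia|congruence]. }
    destruct (dec_inh_nat_subset_has_unique_least_element (fun j => fr m k (S i) j = S i))
      as [j [[H1 H2] _]].
    + intros j. destruct (Nat.eq_dec (fr m k (S i) j) (S i)); auto.
    + now exists j0.
    + exists j. split; auto.
Qed.

(** Before the index [js] the value i does not occur, so the window moves up by one; from [js] on
    the values [u0 + i] lie in [i + 1, i + k]. The residues agree since [js] · m ≡ i modulo k. *)
Lemma fr_spec m k i : Nat.gcd m k = 1%nat -> (0 < m)%nat -> (0 < k)%nat -> fr_window m k i.
Proof.
  intros G Hm Hk. induction i as [|i W].
  - intros j. simpl. unfold base. rewrite Nat.Div0.mod_mod.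
    assert (B := base_lt m k j Hk). unfold base in B. lia.
  - destruct (js_spec m k i G Hm Hk W) as [J1 J2].
    intros j. rewrite fr_S. destruct (Nat.ltb_spec j (js m k i)) as [L|L].
    + destruct (W j) as [W1 W2]. split; [|exact W2].
      assert (fr m k i j <> i) by (intros E; apply J2 in E; lia). lia.
    + destruct (u0_spec m k (j - js m k i) Hk) as [U1 U2]. split; [lia|].
      destruct (W (js m k i)) as [_ W2]. rewrite J1 in W2.
      rewrite Nat.Div0.add_mod, U2, W2, <- Nat.Div0.add_mod. f_equal. nia.
Qed.

Section Fronts.
Variables m k : nat.
Hypothesis G : Nat.gcd m k = 1%nat.
Hypothesis Hm : (0 < m)%nat.
Hypothesis Hk : (0 < k)%nat.

Lemma fr_unique i j a : (i <= a < i + k)%nat -> (a mod k = (j * m) mod k)%nat ->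
  fr m k i j = a.
Proof.
  intros H E. destruct (fr_spec m k i G Hm Hk j) as [W1 W2].
  apply (mod_window_unique k i); [exact W1|exact H|congruence].
Qed.

Lemma fr_upper i j : fr m k (S i) (js m k i + j) = (u0 m k j + i)%nat.
Proof.
  rewrite fr_S. destruct (Nat.ltb_spec (js m k i + j) (js m k i)); [lia|].
  do 2 f_equal. lia.
Qed.

(** The fit between wedges: from [js] on, the old front is the lower boundary of wedge i, because
    both have the same residues and take values in the same window. *)
Lemma fr_lower i j : fr m k i (js m k i + j) = (base m k j + i)%nat.
Proof.
  apply fr_unique.
  - assert (B := base_lt m k j Hk). lia.
  - destruct (js_spec m k i G Hm Hk (fr_spec m k i G Hm Hk)) as [J _].
    destruct (fr_spec m k i G Hm Hk (js m k i)) as [_ W]. rewrite J in W.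
    unfold base. rewrite Nat.Div0.add_mod, Nat.Div0.mod_mod, W, <- Nat.Div0.add_mod.
    f_equal. nia.
Qed.

Lemma fr_agree i j : (j < js m k i)%nat -> fr m k (S i) j = fr m k i j.
Proof. intros H. rewrite fr_S. now destruct (Nat.ltb_spec j (js m k i)); [|lia]. Qed.

Lemma curve_fr_agree n i j : (j <= js m k i)%nat ->
  curve_pt n origin (fr m k (S i)) j = curve_pt n origin (fr m k i) j.
Proof. intros H. apply curve_pt_ext. intros l Hl. apply fr_agree. lia. Qed.

(** Fronts i and i + 1 agree before [js], so the boundary of the wedge may be replaced by two whole
    fronts cut at the same index. In this form the sum over i telescopes up to tails. *)
Lemma wedge_angle_sum n i x N :
  let z := ginv (2 * PI * INR i / INR n) (wedge_shift n m k i) x in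
  bsum N (fun r => bsum (S r) (fun c => angle_sum z (wedge0_tile n m k r c))) =
  csum x (curve_pt n origin (fr m k i)) (js m k i + N * k)
  - csum x (curve_pt n origin (fr m k (S i))) (js m k i + N * k) + zigzag n m k z N.
Proof.
  intros z. rewrite wedge0_angle_sum by assumption.
  assert (L := csum_shift n (fr m k i) (base m k) (js m k i) i (N * k) x (fr_lower i)).
  assert (U := csum_shift n (fr m k (S i)) (u0 m k) (js m k i) i (N * k) x (fr_upper i)).
  rewrite curve_fr_agree in U by lia.
  rewrite <- wedge_shift_js in L, U. fold z in L, U. rewrite L, U.
  assert (E : csum x (curve_pt n origin (fr m k (S i))) (js m k i) =
              csum x (curve_pt n origin (fr m k i)) (js m k i)).
  { apply bsum_ext. intros j Hj. now rewrite !curve_fr_agree by lia. }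
  rewrite E. ring.
Qed.

(* Both sides are the sum of [u0]-directions over a full period, read off from
   different starting indices. *)
Lemma d0_d1_rot n : vadd (d0 n m k) (d1 n k) = rot (2 * PI / INR n) (d0 n m k).
Proof.
  set (c := curve_pt n origin (u0 m k)). set (s := js m k 1).
  (* Front 1 is [u0], so its tail from [s] is the base turned by 2π/n; one period of this tail has
     displacement [rot (2 * PI / INR n) d0]. *)
  assert (Hs : forall j, u0 m k (s + j) = (base m k j + 1)%nat) by (intros j; apply (fr_lower 1)).
  assert (P : forall j, c (j + k)%nat = vadd (c j) (vadd (d0 n m k) (d1 n k))).
  { induction j as [|j IH].
    - simpl plus. unfold c. assert (C := curve_u0 n m k 0 k G Hk ltac:(lia)).
      simpl plus in C. rewrite C. rewrite curve_useq by lia.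
      rewrite curve_pt_translate. fold (d0 n m k). simpl.
      generalize (d0 n m k), (d1 n k). intros. vsolve.
    - change (c (S j + k)%nat) with (vadd (c (j + k)%nat) (vdir n (u0 m k (j + k)))).
      change (c (S j)) with (vadd (c j) (vdir n (u0 m k j))).
      replace (u0 m k (j + k)) with (u0 m k j).
      2:{ rewrite <- (u0_period m k 1 j). f_equal. lia. }
      rewrite IH. generalize (d0 n m k), (d1 n k), (c j), (vdir n (u0 m k j)).
      intros. vsolve. }
  assert (Q := curve_shift n (u0 m k) (base m k) s 1 k Hs). fold c in Q. rewrite P in Q.
  assert (C := curve_base n m k 0 k ltac:(lia)). simpl plus in C. rewrite C in Q.
  rewrite curve_pt_translate in Q. fold (d0 n m k) in Q.
  replace (vadd (vscale (INR 0) (d0 n m k)) (d0 n m k)) with (d0 n m k) in Q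
    by (simpl INR; generalize (d0 n m k); intros; vsolve).
  simpl INR in Q. rewrite Rmult_1_r in Q. unfold gmap in Q.
  revert Q. generalize (rot (2 * PI / INR n) (d0 n m k)), (vadd (d0 n m k) (d1 n k)), (c s).
  intros [a1 a2] [b1 b2] [c1 c2] Q. unfold vadd in Q; simpl in Q.
  injection Q as Q1 Q2. f_equal; lra.
Qed.

End Fronts.

(** * Limits *)

Lemma vdir_norm n a : vnorm (vdir n a) = 1.
Proof.
  unfold vnorm, vdot, vdir; simpl. assert (H := sin2_cos2 (2 * PI * INR a / INR n)).
  unfold Rsqr in H. rewrite Rplus_comm, H. apply sqrt_1.
Qed.

Lemma cos_le_abs b th : 0 <= b <= PI -> - b <= th <= b -> cos b <= cos th.
Proof.
  intros Hb H. destruct (Rle_dec 0 th) as [T|T].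
  - apply cos_decr_1; lra.
  - rewrite <- (cos_neg th). apply cos_decr_1; lra.
Qed.

(* All steps lie within an angle [π(k-1)/n < π/2] of the mean direction of the window. *)
Lemma curve_growth n k i : (0 < k)%nat -> (2 * k <= n)%nat ->
  exists c, 0 < c /\ forall f, (forall j, (i <= f j < i + k)%nat) ->
    forall J, c * INR J <= vnorm (curve_pt n origin f J).
Proof.
  intros Hk Hn. set (b := PI * (INR k - 1) / INR n). assert (P := PI_RGT_0).
  assert (N : 0 < INR n) by (apply lt_0_INR; lia).
  assert (K1 : 1 <= INR k) by (apply (le_INR 1); lia).
  assert (KN : 2 * INR k <= INR n).
  { apply le_INR in Hn. rewrite mult_INR in Hn. simpl in Hn. lra. }
  assert (B : 0 <= b < PI / 2).
  { unfold b. split.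
    - apply Rmult_le_pos; [apply Rmult_le_pos; lra|left; now apply Rinv_0_lt_compat].
    - apply Rmult_lt_reg_r with (INR n); [lra|].
      replace (PI * (INR k - 1) / INR n * INR n) with (PI * (INR k - 1)) by (field; lra).
      nra. }
  exists (cos b). split; [apply cos_gt_0; lra|].
  intros f Hf J. set (mu := PI * (2 * INR i + INR k - 1) / INR n).
  set (e := (cos mu, sin mu) : R2).
  assert (Ne : vnorm e = 1).
  { unfold vnorm, vdot, e; simpl. assert (H := sin2_cos2 mu). unfold Rsqr in H.
    rewrite Rplus_comm, H. apply sqrt_1. }
  assert (S : forall j, cos b <= vdot (vdir n (f j)) e).
  { intros j. unfold vdot, vdir, e; simpl. rewrite <- cos_minus.
    apply cos_le_abs; [lra|]. destruct (Hf j) as [F1 F2].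
    assert (F3 : (f j + 1 <= i + k)%nat) by lia.
    apply le_INR in F1, F3. rewrite !plus_INR in F3. simpl in F3.
    assert (E : 2 * PI * INR (f j) / INR n - mu
      = PI * (2 * INR (f j) - 2 * INR i - INR k + 1) / INR n) by (unfold mu; field; lra).
    rewrite E. unfold b. split.
    - apply Rmult_le_reg_r with (INR n); [lra|]. field_simplify; [|lra|lra].
      nra.
    - apply Rmult_le_reg_r with (INR n); [lra|]. field_simplify; [|lra|lra].
      nra. }
  assert (D : cos b * INR J <= vdot (curve_pt n origin f J) e).
  { induction J as [|J IH].
    - simpl. unfold vdot, origin; simpl. lra.
    - rewrite S_INR. simpl curve_pt.
      assert (E : vdot (vadd (curve_pt n origin f J) (vdir n (f J))) e =
        vdot (curve_pt n origin f J) e + vdot (vdir n (f J)) e)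
        by (unfold vdot, vadd; simpl; ring).
      rewrite E. specialize (S J). lra. }
  assert (C := vdot_le_norm (curve_pt n origin f J) e). rewrite Ne in C. lra.
Qed.

Lemma nat_above (a : R) : exists N : nat, a < INR N.
Proof.
  destruct (archimed a) as [H _]. exists (Z.to_nat (Z.max 0 (up a))).
  rewrite INR_IZR_INZ, Z2Nat.id by lia.
  assert (IZR (up a) <= IZR (Z.max 0 (up a))) by (apply IZR_le; lia). lra.
Qed.

Lemma far_edge_angle n k i f x : (0 < k)%nat -> (2 * k <= n)%nat ->
  (forall j, (i <= f j < i + k)%nat) ->
  forall eps, 0 < eps -> exists J0, forall J, (J0 <= J)%nat ->
    Rabs (edge_angle x (curve_pt n origin f J, curve_pt n origin f (S J))) < eps.
Proof.
  intros Hk Hn Hf eps He. destruct (curve_growth n k i Hk Hn) as [c [Hc Gr]].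
  specialize (Gr f Hf).
  (* From this index on the vertices are farther than 2 + 4/eps from [x]: the 2 is the hypothesis of
     [pang_far], and 4/eps brings its bound below [eps]. *)
  destruct (nat_above ((vnorm x + 2 + 4 / eps) / c)) as [J0 HJ0].
  exists J0. intros J HJ. apply le_INR in HJ.
  assert (L : vnorm x + 2 + 4 / eps < c * INR J).
  { apply Rlt_le_trans with (c * INR J0); [|nra].
    apply Rmult_lt_reg_r with (/ c); [now apply Rinv_0_lt_compat|].
    replace (c * INR J0 * / c) with (INR J0) by (field; lra). exact HJ0. }
  rewrite edge_angle_pang. simpl curve_pt.
  set (q := curve_pt n origin f J) in *.
  replace (vsub (vadd q (vdir n (f J))) x) with (vadd (vsub q x) (vdir n (f J)))
    by (generalize (vdir n (f J)); intros; vsolve).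
  assert (T : vnorm q <= vnorm (vsub q x) + vnorm x).
  { replace q with (vadd (vsub q x) x) at 1 by vsolve. apply vnorm_vadd. }
  assert (F : 0 < 4 / eps) by (apply Rdiv_lt_0_compat; lra).
  specialize (Gr J). fold q in Gr.
  eapply Rle_lt_trans; [apply pang_far; [apply vdir_norm|lra]|].
  apply Rmult_lt_reg_r with (vnorm (vsub q x)); [lra|].
  replace (4 / vnorm (vsub q x) * vnorm (vsub q x)) with (4 / eps * eps) by (field; lra).
  rewrite (Rmult_comm eps). apply Rmult_lt_compat_r; lra.
Qed.

Lemma Un_cv_0 : Un_cv (fun _ => 0) 0.
Proof.
  intros eps He. exists 0%nat. intros. unfold Rdist. rewrite Rminus_diag, Rabs_R0. lra.
Qed.

(** A fixed number of edges moving to infinity, each seen under an angle tending to 0. It lets a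
    front cut at [js + N * k] be compared with one cut at [N * k]. *)
Lemma csum_tail_cv n k i f x s : (0 < k)%nat -> (2 * k <= n)%nat ->
  (forall j, (i <= f j < i + k)%nat) ->
  Un_cv (fun N => csum x (curve_pt n origin f) (s + N * k)
                  - csum x (curve_pt n origin f) (N * k)) 0.
Proof.
  intros Hk Hn Hf. induction s as [|s IH].
  - eapply Un_cv_ext; [|apply Un_cv_0]. intros N. simpl. ring.
  - eapply Un_cv_ext with (fun N => (csum x (curve_pt n origin f) (s + N * k)
        - csum x (curve_pt n origin f) (N * k))
      + edge_angle x (curve_pt n origin f (s + N * k), curve_pt n origin f (S (s + N * k)))).
    { intros N. unfold csum. simpl. ring. }
    replace 0 with (0 + 0) by ring. apply CV_plus; [exact IH|].
    intros eps He. destruct (far_edge_angle n k i f x Hk Hn Hf eps He) as [J0 H].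
    exists J0. intros N HN. unfold Rdist. rewrite Rminus_0_r. apply H. nia.
Qed.

Lemma d0_norm_pos n m k : (0 < k)%nat -> (2 * k <= n)%nat -> 0 < vnorm (d0 n m k).
Proof.
  intros Hk Hn. destruct (curve_growth n k 0 Hk Hn) as [c [Hc Gr]].
  specialize (Gr (base m k)). assert (C := curve_base n m k 0 k ltac:(lia)).
  simpl plus in C.
  assert (E : d0 n m k = curve_pt n origin (base m k) k).
  { rewrite C, curve_pt_translate. fold (d0 n m k). simpl INR.
    generalize (d0 n m k). intros. vsolve. }
  rewrite E. eapply Rlt_le_trans; [|apply Gr].
  - apply Rmult_lt_0_compat; [exact Hc|]. apply lt_0_INR. lia.
  - intros j. assert (B := base_lt m k j Hk). lia.
Qed.

Lemma vsub_vscale0 p z : vsub p (vscale 0 z) = p.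
Proof. vsolve. Qed.

(** Scaling by 1/N turns the angle into that between D - z/N and D' - z/N, and [pang] is continuous
    where its denominator is positive. *)
Lemma pang_limit D D' z : 0 < pden D D' -> 
  Un_cv (fun N => pang (vsub (vscale (INR N) D) z) (vsub (vscale (INR N) D') z)) (pang D D').
Proof.
  intros HD.
  set (F := fun s => pang (vsub D (vscale s z)) (vsub D' (vscale s z))).
  assert (F0 : F 0 = pang D D').
  { unfold F. now rewrite !vsub_vscale0. }
  assert (C : continuity_pt F 0).
  { unfold F, pang.
    assert (Cn : forall E : R2, continuity_pt (fun s => vnorm (vsub E (vscale s z))) 0).
    { intros E. apply (continuity_pt_comp
        (fun s => vdot (vsub E (vscale s z)) (vsub E (vscale s z))) sqrt).
      - unfold vdot, vsub, vscale; simpl. reg.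
      - apply continuity_pt_sqrt. apply vdot_self_ge0. }
    apply (continuity_pt_mult (fun _ => 2)); [apply continuity_pt_const; now intros ? ?|].
    apply (continuity_pt_comp (fun s =>
      vcross (vsub D (vscale s z)) (vsub D' (vscale s z)) /
      (vnorm (vsub D (vscale s z)) * vnorm (vsub D' (vscale s z)) +
       vdot (vsub D (vscale s z)) (vsub D' (vscale s z)))) atan).
    2:{ apply derivable_continuous_pt, derivable_pt_atan. }
    apply (continuity_pt_mult
      (fun s => vcross (vsub D (vscale s z)) (vsub D' (vscale s z)))).
    { unfold vcross, vsub, vscale; simpl. reg. }
    apply (continuity_pt_inv (fun s => vnorm (vsub D (vscale s z)) * vnorm (vsub D' (vscale s z)) +
       vdot (vsub D (vscale s z)) (vsub D' (vscale s z)))).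
    - apply (continuity_pt_plus
        (fun s => vnorm (vsub D (vscale s z)) * vnorm (vsub D' (vscale s z)))).
      + apply (continuity_pt_mult (fun s => vnorm (vsub D (vscale s z)))); auto.
      + unfold vdot, vsub, vscale; simpl. reg.
    - rewrite !vsub_vscale0. unfold pden in HD. lra. }
  intros eps He. destruct (C eps He) as [alp [Ha HC]].
  destruct (nat_above (1 / alp)) as [N0 HN0]. exists (S N0). intros N HN.
  assert (N1 : 0 < INR N) by (apply lt_0_INR; lia).
  assert (N2 : 1 / alp < INR N).
  { apply Rlt_trans with (INR N0); [exact HN0|]. apply lt_INR. lia. }
  assert (E : pang (vsub (vscale (INR N) D) z) (vsub (vscale (INR N) D') z) = F (/ INR N)).
  { unfold F. rewrite <- (pang_vscale (INR N) (vsub D _)) by exact N1.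
    f_equal; unfold vsub, vscale; simpl; f_equal; field; lra. }
  rewrite E, <- F0. apply HC. split.
  - split; [exact I|]. apply Rlt_not_eq. now apply Rinv_0_lt_compat.
  - simpl. unfold Rdist. rewrite Rminus_0_r, Rabs_pos_eq by (left; now apply Rinv_0_lt_compat).
    apply Rmult_lt_reg_r with (INR N); [exact N1|]. rewrite Rinv_l by lra.
    apply Rmult_lt_reg_r with (/ alp); [now apply Rinv_0_lt_compat|].
    replace (alp * INR N * / alp) with (INR N) by (field; lra). lra.
Qed.

(** As |D| = |D'|, the vector e = D + D' is orthogonal to D' - D = [d1], so all lattice points of
    row N have the same product N [kap] with e. For large N the whole zigzag lies in an open
    half-plane seen from z, where angles add; it is then seen under the angle between N D and N
    D'. *)
Lemma zigzag_cv n m k z : Nat.gcd m k = 1%nat -> (0 < m)%nat -> (m < k)%nat -> (2 * k <= n)%nat ->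
  Un_cv (zigzag n m k z) (2 * PI / INR n).
Proof.
  intros G Hm Hmk Hn. assert (P := PI_RGT_0).
  assert (N4 : 4 <= INR n) by (replace 4 with (INR 4) by (simpl; ring); apply le_INR; lia).
  set (phi := 2 * PI / INR n).
  assert (Hphi : 0 < phi < PI).
  { unfold phi. split; [apply Rdiv_lt_0_compat; lra|].
    apply Rmult_lt_reg_r with (INR n); [lra|].
    replace (2 * PI / INR n * INR n) with (2 * PI) by (field; lra). nra. }
  assert (HR := d0_d1_rot m k G Hm ltac:(lia) n). fold phi in HR.
  assert (ND := d0_norm_pos n m k ltac:(lia) Hn).
  set (D := d0 n m k) in *. set (D' := rot phi D) in *.
  assert (DD : 0 < vdot D D) by (rewrite <- vnorm_sqr; nra).
  assert (Edot : vdot D D' = vdot D D * cos phi) by (unfold D', vdot, rot; simpl; ring).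
  assert (Hc : 0 < 1 + cos phi).
  { assert (cos PI < cos phi) by (apply cos_decreasing_1; lra). rewrite cos_PI in H. lra. }
  assert (Edot' : vdot D' D' = vdot D D) by apply vdot_rot.
  set (e := vadd D D'). set (kap := vdot D D * (1 + cos phi)).
  assert (Hkap : 0 < kap) by (apply Rmult_lt_0_compat; lra).
  assert (HL : forall N c, lattice_pt n m k N c =
     vadd (vscale (INR N) D) (vscale (INR c) (vsub D' D))).
  { intros N c. unfold lattice_pt. fold D. do 2 f_equal. rewrite <- HR.
    generalize (d1 n k), D. intros. vsolve. }
  assert (HLe : forall N c, vdot (lattice_pt n m k N c) e = INR N * kap).
  { intros N c. rewrite HL. unfold e, kap.
    transitivity (INR N * (vdot D D + vdot D D') + INR c * (vdot D' D' - vdot D D)).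
    - unfold vdot, vadd, vscale, vsub; simpl. ring.
    - rewrite Edot, Edot'. ring. }
  assert (Hv : forall a, - vnorm e <= vdot (vdir n a) e).
  { intros a. assert (A := vdot_ge_norm (vdir n a) e). rewrite vdir_norm in A. lra. }
  assert (Hz : vdot z e <= vnorm z * vnorm e) by apply vdot_le_norm.
  destruct (nat_above ((vnorm e + vnorm z * vnorm e) / kap)) as [N0 HN0].
  assert (Ne := vnorm_ge0 e).
  assert (Z : forall N, (N0 <= N)%nat ->
     zigzag n m k z N = pang (vsub (vscale (INR N) D) z) (vsub (vscale (INR N) D') z)).
  { intros N HN. apply le_INR in HN.
    assert (B : vnorm e + vnorm z * vnorm e < INR N * kap).
    { apply Rlt_le_trans with (INR N0 * kap); [|nra].
      apply Rmult_lt_reg_r with (/ kap); [now apply Rinv_0_lt_compat|].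
      replace (INR N0 * kap * / kap) with (INR N0) by (field; lra). exact HN0. }
    assert (Pl : forall c, 0 < vdot (vsub (lattice_pt n m k N c) z) e).
    { intros c. specialize (HLe N c).
      replace (vdot (vsub (lattice_pt n m k N c) z) e)
        with (vdot (lattice_pt n m k N c) e - vdot z e)
        by (unfold vdot, vsub; simpl; ring). lra. }
    assert (Pv : forall c a, 0 < vdot (vsub (vadd (lattice_pt n m k N c) (vdir n a)) z) e).
    { intros c a. specialize (HLe N c). specialize (Hv a).
      replace (vdot (vsub (vadd (lattice_pt n m k N c) (vdir n a)) z) e)
        with (vdot (lattice_pt n m k N c) e + vdot (vdir n a) e - vdot z e)
        by (unfold vdot, vsub, vadd; simpl; ring). lra. }
    assert (Q : forall c, bsum c (fun c =>
      edge_angle z (lattice_pt n m k N c, vadd (lattice_pt n m k N c) (vdir n k))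
      - edge_angle z (lattice_pt n m k N (S c), vadd (lattice_pt n m k N (S c)) (vdir n 0)))
      = pang (vsub (lattice_pt n m k N 0) z) (vsub (lattice_pt n m k N c) z)).
    { induction c as [|c IH].
      - simpl. symmetry. apply pang_eq0. unfold vcross. ring.
      - change (bsum (S c) ?f) with (bsum c f + f c). cbv beta. rewrite IH.
        unfold Rminus. rewrite <- edge_angle_rev, !edge_angle_pang.
        replace (vadd (lattice_pt n m k N (S c)) (vdir n 0))
          with (vadd (lattice_pt n m k N c) (vdir n k)).
        2:{ unfold lattice_pt, d1. rewrite (S_INR c).
            generalize (d0 n m k), (vdir n k), (vdir n 0). intros. vsolve. }
        rewrite <- Rplus_assoc.
        rewrite (pang_add_halfplane e); [| apply Pl | apply Pl | apply Pv].
        apply (pang_add_halfplane e); [apply Pl | apply Pv | apply Pl]. }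
    unfold zigzag. rewrite Q, !HL. f_equal.
    - simpl INR at 2. generalize D, D'. intros. vsolve.
    - generalize D, D'. intros. vsolve. }
  assert (L : Un_cv (fun N => pang (vsub (vscale (INR N) D) z) (vsub (vscale (INR N) D') z))
     phi).
  { rewrite <- (pang_rot_self phi D Hphi ND) at 1. fold D'. apply pang_limit.
    apply (vdot_pos_pden e); unfold e.
    - replace (vdot D (vadd D D')) with (vdot D D + vdot D D')
        by (unfold vdot, vadd; simpl; ring).
      rewrite Edot. unfold kap in Hkap. lra.
    - replace (vdot D' (vadd D D')) with (vdot D D' + vdot D' D')
        by (unfold vdot, vadd; simpl; ring).
      rewrite Edot, Edot'. unfold kap in Hkap. lra. }
  intros eps He. destruct (L eps He) as [N1 H1].
  exists (Nat.max N0 N1). intros N HN. rewrite Z by lia. apply H1. lia.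
Qed.

Definition region_sum (n m k w : nat) (x : R2) (N : nat) : R :=
  bsum w (fun i => bsum N (fun r => bsum (S r) (fun c =>
    angle_sum (ginv (2 * PI * INR i / INR n) (wedge_shift n m k i) x) (wedge0_tile n m k r c)))).

(** Each wedge contributes the difference of two successive fronts, up to vanishing tails, and a
    zigzag tending to 2π/n; only the first and the last front remain. *)
Lemma region_sum_cv n m k w x :
  Nat.gcd m k = 1%nat -> (0 < m)%nat -> (m < k)%nat -> (2 * k <= n)%nat ->
  Un_cv (fun N => region_sum n m k w x N
    - (csum x (curve_pt n origin (fr m k 0)) (N * k)
       - csum x (curve_pt n origin (fr m k w)) (N * k)))
    (INR w * (2 * PI / INR n)).
Proof.
  intros G Hm Hmk Hn. assert (Hk : (0 < k)%nat) by lia.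
  induction w as [|w IH].
  - simpl INR. rewrite Rmult_0_l. eapply Un_cv_ext; [|apply Un_cv_0].
    intros N. unfold region_sum. simpl bsum. ring.
  - set (z := ginv (2 * PI * INR w / INR n) (wedge_shift n m k w) x).
    assert (T : forall i, Un_cv (fun N => csum x (curve_pt n origin (fr m k i)) (js m k w + N * k)
                  - csum x (curve_pt n origin (fr m k i)) (N * k)) 0).
    { intros i. apply (csum_tail_cv n k i); [exact Hk|exact Hn|].
      intros j. apply (fr_spec m k i G Hm Hk j). }
    assert (C := CV_plus _ _ _ _ IH
      (CV_plus _ _ _ _ (CV_minus _ _ _ _ (T w) (T (S w))) (zigzag_cv n m k z G Hm Hmk Hn))).
    rewrite S_INR. replace ((INR w + 1) * (2 * PI / INR n))
      with (INR w * (2 * PI / INR n) + (0 - 0 + 2 * PI / INR n)) by ring.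
    eapply Un_cv_ext; [|exact C]. intros N. cbv beta.
    unfold region_sum at 2. change (bsum (S w) ?f) with (bsum w f + f w). cbv beta.
    rewrite (wedge_angle_sum m k G Hm Hk n w x N). fold z. unfold region_sum. ring.
Qed.

(** * The tiling *)

Definition copy_angle (offset : bool) (t q : nat) : R :=
  if offset then (if (q =? 0)%nat then 0 else PI) else 2 * PI * INR q / INR t.

(** The half-turn about the midpoint of the segment from the origin to v_0 is the half-turn about
    the origin followed by the translation by v_0. *)
Definition copy_shift (offset : bool) (n q : nat) : R2 :=
  if offset then (if (q =? 0)%nat then origin else vdir n 0) else origin.

Lemma copy_map_gmap offset n t q p :
  copy_map offset n t q p = gmap (copy_angle offset t q) (copy_shift offset n q) p.
Proof.
  unfold copy_map, copy_angle, copy_shift, gmap. destruct offset.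
  - destruct (q =? 0)%nat.
    + unfold rot. rewrite cos_0, sin_0. vsolve.
    + unfold rot. rewrite cos_PI, sin_PI. generalize (vdir n 0). intros.
      destruct p, r. unfold vadd, vsub, vscale, origin; simpl. f_equal; field.
  - unfold vadd, origin, rot. simpl. f_equal; ring.
Qed.

Definition copy_pt (offset : bool) (n t q : nat) (x : R2) : R2 :=
  ginv (copy_angle offset t q) (copy_shift offset n q) x.

Lemma krinkle_tile_gmap offset m k t q i r c :
  let n := krinkle_n offset m k t in
  krinkle_tile offset m k t (q, i, r, c) =
  map (gmap (copy_angle offset t q) (copy_shift offset n q))
    (map (gmap (2 * PI * INR i / INR n) (wedge_shift n m k i)) (wedge0_tile n m k r c)).
Proof.
  intros n. unfold krinkle_tile. fold n. apply map_ext. intros p. apply copy_map_gmap.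
Qed.

Lemma krinkle_tile_winding offset m k t q i r c x :
  let n := krinkle_n offset m k t in
  winding (krinkle_tile offset m k t (q, i, r, c)) x =
  / (2 * PI) * angle_sum (ginv (2 * PI * INR i / INR n) (wedge_shift n m k i)
    (copy_pt offset n t q x)) (wedge0_tile n m k r c).
Proof.
  intros n. rewrite winding_angle_sum, krinkle_tile_gmap, !angle_sum_gmap.
  fold n. unfold Rdiv. apply Rmult_comm.
Qed.

Lemma krinkle_n_ge offset m k t : (m < k)%nat -> (2 <= t)%nat -> (2 * k <= krinkle_n offset m k t)%nat.
Proof. intros. unfold krinkle_n. destruct offset; nia. Qed.

Lemma krinkle_tile_triangulated offset m k t idx : (m < k)%nat -> (2 <= t)%nat ->
  exists tris, triangulated (krinkle_tile offset m k t idx) tris.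
Proof.
  intros Hmk Ht. destruct idx as [[[q i] r] c]. rewrite krinkle_tile_gmap.
  set (n := krinkle_n offset m k t).
  assert (T := tile_triangulated n m k
    (vadd (vscale (INR r) (d0 n m k)) (vscale (INR c) (d1 n k)))
    ltac:(lia) (krinkle_n_ge offset m k t Hmk Ht)).
  destruct (triangulated_gmap (2 * PI * INR i / INR n) (wedge_shift n m k i) _ _ T) as [tr1 T1].
  exact (triangulated_gmap _ _ _ _ T1).
Qed.

Lemma Un_cv_bsum (Q : nat) (u : nat -> nat -> R) (l : R) :
  (forall q, Un_cv (u q) l) -> Un_cv (fun N => bsum Q (fun q => u q N)) (INR Q * l).
Proof.
  intros H. induction Q as [|Q IH].
  - simpl. rewrite Rmult_0_l. apply Un_cv_0.
  - rewrite S_INR. replace ((INR Q + 1) * l) with (INR Q * l + l) by ring.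
    apply (CV_plus _ _ _ _ IH (H Q)).
Qed.

Lemma rot_rot a b p : rot a (rot b p) = rot (a + b) p.
Proof. unfold rot; simpl. rewrite cos_plus, sin_plus. f_equal; ring. Qed.

Lemma ginv_origin th x : ginv th origin x = rot (- th) x.
Proof. unfold ginv. f_equal. vsolve. Qed.

Lemma csum_0 x c : csum x c 0 = 0.
Proof. reflexivity. Qed.

Definition patch (Q w N : nat) : list (nat * nat * nat * nat) :=
  flat_map (fun q => flat_map (fun i => flat_map (fun r =>
    map (fun c => (q, i, r, c)) (seq 0 (S r))) (seq 0 N)) (seq 0 w)) (seq 0 Q).

Lemma in_patch Q w N q i r c :
  In (q, i, r, c) (patch Q w N) <-> (q < Q /\ i < w /\ r < N /\ c <= r)%nat.
Proof.
  unfold patch. split.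
  - intros H. apply in_flat_map in H. destruct H as [q' [Hq H]].
    apply in_flat_map in H. destruct H as [i' [Hi H]].
    apply in_flat_map in H. destruct H as [r' [Hr H]].
    apply in_map_iff in H. destruct H as [c' [E Hc]]. injection E as -> -> -> ->.
    apply in_seq in Hq, Hi, Hr, Hc. lia.
  - intros [Hq [Hi [Hr Hc]]].
    apply in_flat_map. exists q. split; [apply in_seq; lia|].
    apply in_flat_map. exists i. split; [apply in_seq; lia|].
    apply in_flat_map. exists r. split; [apply in_seq; lia|].
    apply in_map. apply in_seq. lia.
Qed.

Lemma lsum_patch f Q w N :
  lsum f (patch Q w N) =
  bsum Q (fun q => bsum w (fun i => bsum N (fun r => bsum (S r) (fun c => f (q, i, r, c))))).
Proof.
  unfold patch. rewrite lsum_flat_map, lsum_seq. apply bsum_ext. intros q _.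
  rewrite lsum_flat_map, lsum_seq. apply bsum_ext. intros i _.
  rewrite lsum_flat_map, lsum_seq. apply bsum_ext. intros r _.
  rewrite lsum_map. apply lsum_seq.
Qed.

Section Copies.
Variables m k t : nat.
Hypothesis Hm : (0 < m)%nat.
Hypothesis Hmk : (m < k)%nat.
Hypothesis G : Nat.gcd m k = 1%nat.
Hypothesis Ht : (2 <= t)%nat.

(** Front k has directions [base + k]: it is the base turned by 2πk/n = 2π/t, which is the base of
    the next copy. The t boundary differences telescope around a full turn. *)
Lemma total_cv_no_offset x :
  Un_cv (fun N => bsum t (fun q =>
    region_sum (t * k) m k k (copy_pt false (t * k) t q x) N)) (2 * PI).
Proof.
  set (n := (t * k)%nat). set (y q := copy_pt false n t q x).
  assert (T0 : 0 < INR t) by (apply lt_0_INR; lia).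
  assert (K0 : 0 < INR k) by (apply lt_0_INR; lia).
  assert (Hn : INR n = INR t * INR k) by apply mult_INR.
  assert (Step : forall q J, csum (y q) (curve_pt n origin (fr m k k)) J =
    csum (y (S q)) (curve_pt n origin (fr m k 0)) J).
  { intros q J.
    assert (E : forall j, fr m k k (0 + j) = (fr m k 0 j + k)%nat).
    { intros j. apply fr_unique; [exact G|exact Hm|lia| |].
      - assert (B := base_lt m k j ltac:(lia)). simpl. lia.
      - replace (fr m k 0 j + k)%nat with (fr m k 0 j + 1 * k)%nat by lia.
        rewrite Nat.Div0.mod_add. simpl. unfold base. apply Nat.Div0.mod_mod. }
    assert (C := csum_shift n (fr m k k) (fr m k 0) 0 k J (y q) E).
    rewrite csum_0, Rminus_0_r in C. simpl plus in C. rewrite <- C. f_equal.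
    simpl curve_pt. unfold y, copy_pt, copy_angle, copy_shift.
    rewrite !ginv_origin, rot_rot. f_equal. rewrite S_INR, Hn. field. lra. }
  assert (Last : y t = y 0%nat).
  { unfold y, copy_pt, copy_angle, copy_shift. rewrite !ginv_origin.
    replace (2 * PI * INR t / INR t) with (2 * PI) by (field; lra).
    simpl INR. replace (2 * PI * 0 / INR t) with 0 by (field; lra).
    unfold rot. rewrite !cos_neg, !sin_neg, cos_2PI, sin_2PI, cos_0, sin_0. reflexivity. }
  assert (C := Un_cv_bsum t _ _ (fun q => region_sum_cv n m k k (y q) G Hm Hmk ltac:(nia))).
  replace (INR t * (INR k * (2 * PI / INR n))) with (2 * PI) in C
    by (rewrite Hn; field; lra).
  eapply Un_cv_ext; [|exact C]. intros N. cbv beta. rewrite bsum_minus.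
  rewrite (bsum_ext t (fun q => csum (y q) (curve_pt n origin (fr m k 0)) (N * k)
      - csum (y q) (curve_pt n origin (fr m k k)) (N * k))
    (fun q => csum (y q) (curve_pt n origin (fr m k 0)) (N * k)
      - csum (y (S q)) (curve_pt n origin (fr m k 0)) (N * k)))
    by (intros q _; now rewrite Step).
  rewrite (bsum_telescope t (fun q => csum (y q) (curve_pt n origin (fr m k 0)) (N * k))).
  rewrite Last. rewrite Rminus_diag, Rminus_0_r. reflexivity.
Qed.

(** As m + w = tk, front w has j-th direction [base (j + 1) + w]: it is the base without its first
    edge, turned by 2πw/n = π. The half-turn of the other copy carries the base minus its first edge
    onto it, which leaves only the first edges of the two bases. *)
Lemma total_cv_offset x :
  let n := (2 * (t * k - m))%nat in
  Un_cv (fun N => bsum 2 (fun q =>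
    region_sum n m k (t * k - m) (copy_pt true n t q x) N)) (2 * PI).
Proof.
  intros n. set (w := (t * k - m)%nat).
  assert (W0 : (0 < w)%nat) by (unfold w; nia). apply lt_0_INR in W0.
  assert (Hn : INR n = 2 * INR w) by (unfold n; rewrite mult_INR; reflexivity).
  set (y z := ginv PI (vdir n 0) z).
  set (b z := csum z (curve_pt n origin (fr m k 0))).
  assert (Y0 : copy_pt true n t 0 x = x).
  { unfold copy_pt, copy_angle, copy_shift. simpl. rewrite ginv_origin.
    unfold rot. rewrite Ropp_0, cos_0, sin_0. destruct x. simpl. f_equal; ring. }
  assert (Y1 : copy_pt true n t 1 x = y x) by reflexivity.
  assert (yE : forall z, y z = vsub (vdir n 0) z).
  { intros z. unfold y, ginv, rot. rewrite cos_neg, sin_neg, cos_PI, sin_PI.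
    generalize (vdir n 0). intros. vsolve. }
  assert (yy : y (y x) = x) by (rewrite !yE; generalize (vdir n 0); intros; vsolve).
  assert (B1 : curve_pt n origin (fr m k 0) 1 = vdir n 0).
  { simpl. unfold base. rewrite Nat.mul_0_l, Nat.Div0.mod_0_l.
    generalize (vdir n 0). intros. vsolve. }
  assert (F : forall z J, csum z (curve_pt n origin (fr m k w)) J = b (y z) (S J) - b (y z) 1%nat).
  { intros z J. set (g j := fr m k 0 (S j)).
    assert (E : forall j, fr m k w (0 + j) = (g j + w)%nat).
    { intros j. apply fr_unique; [exact G|exact Hm|lia| |].
      - assert (B := base_lt m k (S j) ltac:(lia)). unfold g. simpl fr. lia.
      - unfold g. simpl fr. unfold base.
        rewrite Nat.Div0.add_mod_idemp_l.
        replace (S j * m + w)%nat with (j * m + t * k)%nat by (unfold w; nia).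
        apply Nat.Div0.mod_add. }
    assert (C := csum_shift n (fr m k w) g 0 w J z E).
    rewrite csum_0, Rminus_0_r in C. simpl plus in C. rewrite <- C.
    assert (C1 := csum_shift n (fr m k 0) g 1 0 J (y z)
      ltac:(intros j; unfold g; rewrite Nat.add_0_r; reflexivity)).
    unfold b. change (S J) with (1 + J)%nat. rewrite <- C1. f_equal.
    rewrite B1, yE. simpl curve_pt. simpl (INR 0).
    replace (2 * PI * INR w / INR n) with PI by (rewrite Hn; field; lra).
    replace (2 * PI * 0 / INR n) with 0 by (rewrite Hn; field; lra).
    unfold ginv, rot. rewrite Ropp_0, cos_neg, sin_neg, cos_PI, sin_PI, cos_0, sin_0.
    generalize (vdir n 0). intros. vsolve. }
  (* The half-turn exchanges the ends of the first base edge, so the two copies run along it in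
     opposite directions. *)
  assert (E1 : b (y x) 1%nat = - b x 1%nat).
  { unfold b, csum. change (bsum 1 ?f) with (0 + f O). cbv beta. rewrite !B1, !Rplus_0_l.
    simpl curve_pt. unfold y. rewrite <- edge_angle_gmap, <- edge_angle_rev.
    f_equal. unfold gmap, rot. rewrite cos_PI, sin_PI. generalize (vdir n 0). intros.
    f_equal; vsolve. }
  assert (Hn2 : (2 * k <= n)%nat) by (unfold n; nia).
  assert (T : forall z, Un_cv (fun N => b z (1 + N * k)%nat - b z (N * k)%nat) 0).
  { intros z. apply (csum_tail_cv n k 0); [lia|exact Hn2|].
    intros j. apply (fr_spec m k 0 G Hm ltac:(lia) j). }
  assert (C := fun z => region_sum_cv n m k w z G Hm Hmk Hn2).
  assert (D := CV_minus _ _ _ _ (CV_plus _ _ _ _ (C x) (C (y x)))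
    (CV_plus _ _ _ _ (T x) (T (y x)))).
  replace (INR w * (2 * PI / INR n) + INR w * (2 * PI / INR n) - (0 + 0)) with (2 * PI) in D
    by (rewrite Hn; field; lra).
  eapply Un_cv_ext; [|exact D]. intros N. cbv beta. simpl bsum.
  rewrite Y0, Y1, !F, yy. fold (b x) (b (y x)). rewrite E1. simpl plus. ring.
Qed.

Lemma patch_winding_cv offset x :
  Un_cv (fun N => lsum (fun idx => winding (krinkle_tile offset m k t idx) x)
    (patch (krinkle_copies offset t) (krinkle_w offset m k t) N)) 1.
Proof.
  assert (P := PI_RGT_0).
  assert (C : Un_cv (fun N => bsum (krinkle_copies offset t) (fun q =>
    region_sum (krinkle_n offset m k t) m k (krinkle_w offset m k t)
      (copy_pt offset (krinkle_n offset m k t) t q x) N)) (2 * PI)).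
  { destruct offset; [apply total_cv_offset|apply total_cv_no_offset]. }
  assert (D : Un_cv (fun _ => / (2 * PI)) (/ (2 * PI))).
  { intros eps He. exists 0%nat. intros. unfold Rdist. rewrite Rminus_diag, Rabs_R0. lra. }
  assert (E := CV_mult _ _ _ _ D C). rewrite Rinv_l in E by lra.
  eapply Un_cv_ext; [|exact E]. intros N. cbv beta.
  rewrite lsum_patch, <- bsum_scal. apply bsum_ext. intros q _.
  unfold region_sum. rewrite <- bsum_scal. apply bsum_ext. intros i _.
  rewrite <- bsum_scal. apply bsum_ext. intros r _.
  rewrite <- bsum_scal. apply bsum_ext. intros c _.
  symmetry. apply krinkle_tile_winding.
Qed.

End Copies.

(** * Points off finitely many segments *)

Lemma segment_normal e : exists nu, 0 < vnorm nu /\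
  forall z, on_segment e z -> vdot (vsub z (fst e)) nu = 0.
Proof.
  destruct e as [A B]. destruct (Req_dec (vnorm (vsub B A)) 0) as [H|H].
  - exists (1, 0). split.
    + unfold vnorm, vdot; simpl. apply sqrt_lt_R0. lra.
    + intros z [s [_ ->]]. apply vnorm_eq0 in H. simpl. rewrite H.
      unfold vdot, vsub, vadd, vscale, origin; simpl. ring.
  - exists (- snd (vsub B A), fst (vsub B A)). split.
    + destruct (vnorm_ge0 (vsub B A)) as [L|L]; [|lra].
      replace (vnorm _) with (vnorm (vsub B A)); [exact L|].
      unfold vnorm. f_equal. unfold vdot; simpl. ring.
    + intros z [s [_ ->]]. unfold vdot, vsub, vadd, vscale; simpl. ring.
Qed.

(** The induction carries a whole ball. If its centre lies on the line of the next segment, the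
    centre moves by half the radius along the normal and the radius is halved; otherwise the radius
    shrinks to at most the distance from that line. *)
Lemma avoid_segments (l : list (R2 * R2)) x eps : 0 < eps ->
  exists y d, 0 < d /\
    (forall z, vnorm (vsub z y) < d -> vnorm (vsub z x) < eps) /\
    forall z, vnorm (vsub z y) < d -> forall e, In e l -> ~ on_segment e z.
Proof.
  intros He. induction l as [|e l IH].
  - exists x, eps. split; [exact He|]. split; [auto|]. simpl. tauto.
  - destruct IH as [y [d [Hd [Hy Ha]]]].
    destruct (segment_normal e) as [nu [Hnu Hs]].
    assert (K : exists y' d', 0 < d' /\
      (forall z, vnorm (vsub z y') < d' -> vnorm (vsub z y) < d) /\
      vnorm nu * d' <= Rabs (vdot (vsub y' (fst e)) nu)).
    { destruct (Req_dec (vdot (vsub y (fst e)) nu) 0) as [Z|Z].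
      - set (s := d / (2 * vnorm nu)).
        assert (Es : s * vnorm nu = d / 2) by (unfold s; field; lra).
        assert (S0 : 0 < s) by (apply Rdiv_lt_0_compat; lra).
        exists (vadd y (vscale s nu)), (d / 2). split; [lra|]. split.
        + intros z Hz.
          replace (vsub z y) with (vadd (vsub z (vadd y (vscale s nu))) (vscale s nu)) by vsolve.
          eapply Rle_lt_trans; [apply vnorm_vadd|].
          rewrite vnorm_vscale, Rabs_pos_eq, Es by lra. lra.
        + replace (vdot (vsub (vadd y (vscale s nu)) (fst e)) nu)
            with (vdot (vsub y (fst e)) nu + s * vdot nu nu)
            by (unfold vdot, vsub, vadd, vscale; simpl; ring).
          rewrite Z, <- vnorm_sqr, Rplus_0_l, <- Rmult_assoc, Es.
          rewrite Rabs_pos_eq by nra. lra.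
      - set (a := Rabs (vdot (vsub y (fst e)) nu)).
        assert (A0 : 0 < a) by now apply Rabs_pos_lt.
        exists y, (Rmin d (a / vnorm nu)). split; [|split].
        + apply Rmin_pos; [exact Hd|]. now apply Rdiv_lt_0_compat.
        + intros z Hz. eapply Rlt_le_trans; [exact Hz|apply Rmin_l].
        + fold a. apply Rle_trans with (vnorm nu * (a / vnorm nu)).
          * apply Rmult_le_compat_l; [lra|apply Rmin_r].
          * right. field. lra. }
    destruct K as [y' [d' [Hd' [Hin Hfar]]]].
    exists y', d'. split; [exact Hd'|]. split; [auto|].
    intros z Hz e' [<-|He']; [|now apply Ha; [apply Hin|]].
    intros On. apply Hs in On.
    assert (E : vdot (vsub y' (fst e)) nu = - vdot (vsub z y') nu).
    { transitivity (vdot (vsub z (fst e)) nu - vdot (vsub z y') nu); [|rewrite On; ring].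
      unfold vdot, vsub; simpl. ring. }
    rewrite E, Rabs_Ropp in Hfar.
    assert (U := vdot_le_norm (vsub z y') nu). assert (L := vdot_ge_norm (vsub z y') nu).
    assert (Rabs (vdot (vsub z y') nu) <= vnorm (vsub z y') * vnorm nu) by (apply Rabs_le; lra).
    assert (vnorm (vsub z y') * vnorm nu < d' * vnorm nu) by (apply Rmult_lt_compat_r; lra).
    lra.
Qed.

Theorem mainTheorem1 (m k t : nat) (offset : bool) :
  (0 < m)%nat -> (m < k)%nat -> Nat.gcd m k = 1%nat -> (2 <= t)%nat ->
  (forall x : R2, exists idx, valid_index offset m k t idx /\
                              region (krinkle_tile offset m k t idx) x) /\
  (forall idx1 idx2, valid_index offset m k t idx1 -> valid_index offset m k t idx2 ->
     idx1 <> idx2 ->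
     forall x : R2, ~ (interior2 (region (krinkle_tile offset m k t idx1)) x /\
                       interior2 (region (krinkle_tile offset m k t idx2)) x)).
Proof.
  intros Hm Hmk G Ht. set (W x idx := winding (krinkle_tile offset m k t idx) x).
  set (pt := patch (krinkle_copies offset t) (krinkle_w offset m k t)).
  assert (C : forall x, Un_cv (fun N => lsum (W x) (pt N)) 1)
    by (intros x; now apply patch_winding_cv).
  split.
  (* A distance below 1 from the limit 1 excludes a vanishing sum. *)
  - intros x. destruct (C x 1 Rlt_0_1) as [N H]. specialize (H N (Nat.le_refl _)).
    assert (Z : lsum (W x) (pt N) <> 0).
    { intros E. rewrite E in H. unfold Rdist in H. rewrite Rabs_left in H; lra. }
    apply lsum_neq0 in Z. destruct Z as [[[[q i] r] c] [I V]].
    exists (q, i, r, c). split; [|now right].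
    apply in_patch in I. simpl. lia.
  - intros idx1 idx2 V1 V2 Ne x [[e1 [He1 I1]] [e2 [He2 I2]]].
    destruct (krinkle_tile_triangulated offset m k t idx1 Hmk Ht) as [tr1 T1].
    destruct (krinkle_tile_triangulated offset m k t idx2 Hmk Ht) as [tr2 T2].
    set (segs1 := edges (krinkle_tile offset m k t idx1) ++ flat_map tri_edges tr1).
    set (segs2 := edges (krinkle_tile offset m k t idx2) ++ flat_map tri_edges tr2).
    destruct (avoid_segments (segs1 ++ segs2) x (Rmin e1 e2)) as [y [d [Hd [Hy Ha]]]].
    { now apply Rmin_pos. }
    assert (Y : vnorm (vsub y y) < d).
    { replace (vsub y y) with origin by vsolve.
      unfold vnorm, vdot, origin; simpl. rewrite Rmult_0_l, Rplus_0_l, sqrt_0. exact Hd. }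
    specialize (Hy y Y). specialize (Ha y Y).
    assert (W1 : 1 <= W y idx1).
    { apply (triangulated_winding_ge1 _ tr1); [exact T1| |].
      - intros e He. apply Ha. unfold segs1. rewrite !in_app_iff. tauto.
      - destruct (I1 y) as [[e [He On]]|N]; [|exfalso; apply (Ha e); [|exact On]|exact N].
        + eapply Rlt_le_trans; [exact Hy|apply Rmin_l].
        + unfold segs1. rewrite !in_app_iff. tauto. }
    assert (W2 : 1 <= W y idx2).
    { apply (triangulated_winding_ge1 _ tr2); [exact T2| |].
      - intros e He. apply Ha. unfold segs2. rewrite !in_app_iff. tauto.
      - destruct (I2 y) as [[e [He On]]|N]; [|exfalso; apply (Ha e); [|exact On]|exact N].
        + eapply Rlt_le_trans; [exact Hy|apply Rmin_r].
        + unfold segs2. rewrite !in_app_iff. tauto. }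
    destruct (C y 1 Rlt_0_1) as [N0 H].
    destruct idx1 as [[[q1 i1] r1] c1], idx2 as [[[q2 i2] r2] c2].
    (* Large enough for the patch to contain both tiles and for its winding sum at [y] to be below
       2. *)
    set (N := (N0 + S r1 + S r2)%nat). specialize (H N ltac:(lia)).
    assert (S2 : W y (q1, i1, r1, c1) + W y (q2, i2, r2, c2) <= lsum (W y) (pt N)).
    { apply lsum_ge_two; [| | |exact Ne].
      - intros idx. destruct (krinkle_tile_triangulated offset m k t idx Hmk Ht) as [tr T].
        exact (triangulated_winding_ge0 _ tr y T).
      - apply in_patch. simpl in V1. lia.
      - apply in_patch. simpl in V2. lia. }
    unfold Rdist in H. apply Rabs_def2 in H. lra.
Qed.
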